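(* Consider $N$ particles with dynamics $\dot r_k=x_k$, $\dot R_k=R_k\hat u_k$, $R_k=[x_k,y_k,z_k]\in SO(3)$, $r_k\in\mathbb{R}^3$, and the control law $$u_k=R_k^T(x_k\times x_{\mathrm{av}}),\qquad k=1,\dots,N,\qquad x_{\mathrm{av}}=\frac1N\sum_{j=1}^Nx_j .$$ The closed-loop vector field is invariant under an action of the group $SE(3)$. Every solution exists for all $t\ge0$ and asymptotically converges to $\Sigma(0)$. Furthermore, the set $E(0)$ of parallel motions is asymptotically stable in the shape space and every other positive limit set is unstable.
   Context: Model: $r_k\in\mathbb{R}^3$ is the position of particle $k$, $x_k=R_ke_1$ its unit velocity, $u_k\in\mathbb{R}^3$ its control, and $\hat u$ the skew-symmetric matrix with $\hat uv=u\times v$. With $g_k=\begin{bmatrix}R_k&r_k\\0&1\end{bmatrix}\in SE(3)$ and $\xi_k=\mathrm{col}(e_1,u_k)$, $\hat\xi_k=\begin{bmatrix}\hat u_k&e_1\\0&0\end{bmatrix}$, the dynamics are $\dot g_k=g_k\hat\xi_k$. The group $SE(3)$ acts on the state by simultaneous rigid motions $g_k\mapsto hg_k$, $h\in SE(3)$. The shape space is the quotient manifold of the state space by this action; it is described by the shape variables $g_{kj}=g_k^{-1}g_j$, i.e. $R_k^TR_j$ and $R_k^T(r_j-r_k)$. A closed-loop system invariant under the action induces dynamics on the shape space; (asymptotic) stability and instability of sets ''in the shape space'' refer to these induced dynamics. For $\omega_0\in\mathbb{R}^3$, $\Sigma(\omega_0)$ is the set of solutions of the model with common rotation vector $\omega_0$: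 $g_k(t)=g_k(0)e^{\hat\xi_kt}$ with $\xi_k=\mathrm{col}(e_1,R_k^T\omega_0)$, $g_k(0)\in SE(3)$, $k=1,\dots,N$. $E(\omega_0)$ is the subset of $\Sigma(\omega_0)$ corresponding to relative equilibria, i.e. those for which $v_k^a=v_j^a$ for all $k,j$, where $v_k^a=x_k+r_k\times\omega_0$. In particular, $\Sigma(0)$ consists of motions in which every particle moves along a straight line, and $E(0)$ of those in which moreover all velocities $x_k$ are equal (parallel motions). When used as sets to which closed-loop solutions converge or whose stability is asserted, $\Sigma(\omega_0)$ and $E(\omega_0)$ are understood as the sets of closed-loop solutions (motions) of this form. *)

(* Defs.v *)
From HB Require Import structures.
From mathcomp Require Import all_boot all_order all_algebra.
From mathcomp Require Import all_classical all_reals all_analysis.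

Set Implicit Arguments.
Unset Strict Implicit.
Unset Printing Implicit Defensive.

Import Order.TTheory GRing.Theory Num.Theory.
Import numFieldNormedType.Exports.

Local Open Scope classical_set_scope.
Local Open Scope ring_scope.

Section Linear_algebra.
Context {R : realType}.

(* The additions [i + 1] and [i + 2] are those of the cyclic group 'I_3. *)
Definition cross (u v : 'cV[R]_3) : 'cV[R]_3 :=
  \col_(i < 3) (u (i + 1) 0 * v (i + 2) 0 - u (i + 2) 0 * v (i + 1) 0).

(* The j-th column is u x e_j, so that [hat u *m v = cross u v]. *)
Definition hat (u : 'cV[R]_3) : 'M[R]_3 :=
  \matrix_(i < 3, j < 3) cross u (delta_mx j 0) i 0.

Definition e1 : 'cV[R]_3 := delta_mx 0 0.

Definition expm (A : 'M[R]_4) : 'M[R]_4 :=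
  limn (series (fun n : nat => (n`!%:R)^-1 *: A ^+ n)).

Definition frobenius m n (A : 'M[R]_(m, n)) : R :=
  Num.sqrt (\sum_i \sum_j A i j ^+ 2).

End Linear_algebra.

Section Rigid_motions.
Context {R : realType}.

Definition SO3 : set 'M[R]_3 := [set Q | Q^T *m Q = 1%:M /\ \det Q = 1].

Definition orientation (g : 'M[R]_(3 + 1)) : 'M[R]_3 := ulsubmx g.
Definition position (g : 'M[R]_(3 + 1)) : 'cV[R]_3 := ursubmx g.
Definition velocity (g : 'M[R]_(3 + 1)) : 'cV[R]_3 := orientation g *m e1.

Definition SE3 : set 'M[R]_(3 + 1) :=
  [set g | [/\ SO3 (orientation g), dlsubmx g = 0 & drsubmx g = 1%:M]].

(* The matrix of the twist col(e1, u). *)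
Definition twist (u : 'cV[R]_3) : 'M[R]_(3 + 1) := block_mx (hat u) e1 0 0.

End Rigid_motions.

Section Model.
Context {R : realType} {N : nat}.

Definition config : Type := 'I_N -> 'M[R]_(3 + 1).

Definition state : set config := [set g | forall k, SE3 (g k)].

Definition act (h : 'M[R]_(3 + 1)) (g : config) : config :=
  fun k => h *m g k.

Definition average_velocity (g : config) : 'cV[R]_3 :=
  N%:R^-1 *: \sum_(j < N) velocity (g j).

Definition control (g : config) (k : 'I_N) : 'cV[R]_3 :=
  (orientation (g k))^T *m cross (velocity (g k)) (average_velocity g).

(* The product [g k *m twist u] has upper blocks R_k u^ and R_k e1 and zero
   lower blocks: it is the right-hand side of R_k' = R_k u^, r_k' = x_k. *)
Definition closed_loop (g : config) : config :=
  fun k => g k *m twist (control g k).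

(* Solutions on [0, T[. At time 0 only right continuity is asked for: the
   vector field being continuous, the right derivative there follows. *)
Definition solution (T : \bar R) (g : R -> config) : Prop :=
  [/\ forall t : R, 0 <= t -> (t%:E < T)%E -> state (g t),
      forall k, (fun t : R => g t k) @ 0^'+ --> g 0 k &
      forall (t : R) k, 0 < t -> (t%:E < T)%E ->
        is_derive t 1 (fun s : R => g s k) (closed_loop (g t) k)].

Definition Sigma (w : 'cV[R]_3) : set (R -> config) :=
  [set g | state (g 0) /\
    forall (t : R) k, 0 <= t ->
      g t k = g 0 k *m expm (t *: twist ((orientation (g 0 k))^T *m w))].

Definition Rel_equilibria (w : 'cV[R]_3) : set (R -> config) :=
  [set g | Sigma w g /\
    forall (t : R) k j, 0 <= t ->
      velocity (g t k) + cross (position (g t k)) w =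
      velocity (g t j) + cross (position (g t j)) w].

(* The states traversed by the closed-loop solutions that belong to M. *)
Definition states_of (M : set (R -> config)) : set config :=
  [set s | exists g (t : R), [/\ solution +oo%E g, M g, 0 <= t & s = g t]].

(* The Frobenius norm makes this distance invariant under [act h], h in SE(3),
   since g k - g' k has a zero last row. *)
Definition state_close (e : R) (g g' : config) : Prop :=
  forall k, frobenius (g k - g' k) < e.

Definition converges_to (g : R -> config) (A : set config) : Prop :=
  forall e : R, 0 < e -> exists T : R, forall t : R, T <= t ->
    exists2 s, A s & state_close e (g t) s.

End Model.

Arguments config : clear implicits.

Section Shape_space.
Context {R : realType} {N : nat}.

Definition shape_of (g : config R N) : 'I_N -> config R N :=
  fun k j => invmx (g k) *m g j.

Definition shape_space : set ('I_N -> config R N) := shape_of @` state.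

(* The fibres of [shape_of] on states are the SE(3)-orbits and [state_close] is
   SE(3)-invariant: these are the balls of the quotient distance, the infimum
   over h in SE(3) of the distance from a state to h acting on the other. *)
Definition shape_ball (sigma : 'I_N -> config R N) (e : R) :
    set ('I_N -> config R N) :=
  [set tau | exists s s', [/\ state s, state s', shape_of s = sigma,
                              shape_of s' = tau & state_close e s s']].

Definition shape_nbhd (A : set ('I_N -> config R N)) (e : R) :
    set ('I_N -> config R N) :=
  [set tau | exists2 sigma, A sigma & shape_ball sigma e tau].

Definition stable (A : set ('I_N -> config R N)) : Prop :=
  forall e : R, 0 < e -> exists2 d : R, 0 < d &
    forall g, solution +oo%E g -> shape_nbhd A d (shape_of (g 0)) ->
    forall t : R, 0 <= t -> shape_nbhd A e (shape_of (g t)).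

Definition attractive (A : set ('I_N -> config R N)) : Prop :=
  exists2 d : R, 0 < d &
    forall g, solution +oo%E g -> shape_nbhd A d (shape_of (g 0)) ->
    forall e : R, 0 < e -> exists T : R, forall t : R, T <= t ->
      shape_nbhd A e (shape_of (g t)).

Definition asymptotically_stable (A : set ('I_N -> config R N)) : Prop :=
  stable A /\ attractive A.

Definition unstable (A : set ('I_N -> config R N)) : Prop := ~ stable A.

Definition shape_limit_set (g : R -> config R N) :
    set ('I_N -> config R N) :=
  [set sigma | shape_space sigma /\
    forall e T : R, 0 < e -> exists2 t : R, T <= t &
      shape_ball sigma e (shape_of (g t))].

(* Limit points of the relative orientations R_k^T R_j, with unrestricted
   relative positions (as in Sigma 0 and Rel_equilibria 0). When the limiting velocities
   differ, relative positions diverge and [shape_limit_set g] is empty,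
   whereas this set never is. *)
Definition orientation_limit_set (g : R -> config R N) :
    set ('I_N -> config R N) :=
  [set sigma | shape_space sigma /\
    forall e T : R, 0 < e -> exists2 t : R, T <= t &
      forall k j, frobenius (orientation (shape_of (g t) k j) - orientation (sigma k j)) < e].

Definition positive_limit_set (L : set ('I_N -> config R N)) : Prop :=
  exists2 g, solution +oo%E g &
    L = shape_limit_set g \/ L = orientation_limit_set g.

End Shape_space.

(* Main.v *)
(* With p_k = x_k . x_av, the closed loop reads x_k' = x_av - p_k x_k, so the coherence
   V = |x_av|^2 satisfies V' = (2/N) sum_k (V - p_k^2) >= 0. By Barbalat's lemma
   V - p_k^2 -> 0: unless V = 0 along the whole motion, every x_k becomes parallel to
   x_av, and rotating each frame by the small rotation that makes x_k exactly parallel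
   to x_av gives a nearby equilibrium. If V is close to 1 initially it stays so, all p_k
   stay positive, and the x_k align. At an equilibrium N |x_av| is a nonnegative integer.
   A positive limit set lies in one level set of V and consists of equilibria; if one of
   them is not parallel, some x_k is opposed to x_av (or x_av = 0), and moving x_k alone
   increases V by an arbitrarily small amount, after which N |x_av| must climb to at least
   about the next integer.
   Solutions are built by Picard iteration for the field truncated to bounded matrix
   entries; the truncation is never active since R_k remains in SO(3). *)
Require Import Defs.
From mathcomp Require Import all_boot all_order all_algebra.
From mathcomp Require Import all_classical all_reals all_analysis.
From mathcomp Require Import ring lra.

Import Order.TTheory GRing.Theory Num.Theory.
Import numFieldNormedType.Exports.

Set Implicit Arguments.
Unset Strict Implicit.
Unset Printing Implicit Defensive.

Local Open Scope classical_set_scope.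
Local Open Scope ring_scope.

(** * Scalar differential inequalities *)

Section Differentiable_paths.
Context {R : realType}.
Implicit Types (f g df dg h : R -> R) (T : \bar R).

(** No motion is shown to converge to a limit motion, and none need be: the claims concern distances
    to sets, and at each late time a nearby equilibrium is rebuilt from the current state. As this
    turns the frames and leaves every position in place, relative positions, which may diverge, drop
    out of these distances. Equilibria are in general not isolated, even modulo [SE3], so
    instability is not sought by linearization: integrality of [N |x_av|] separates distinct
    equilibrium values of [V] by at least [1 / N^2], and a single finite time at which all
    [V - p_k^2] are small is enough to see this gap nearly crossed. Small [V] is the delicate case,
    because directions are compared after division by [|x_av|]; once [V] is positive, its
    monotonicity supplies a positive lower bound for all later times. *)

Definition dpath T f df : Prop :=
  f @ 0^'+ --> f 0 /\
  forall t, 0 < t -> (t%:E < T)%E -> is_derive t 1 f (df t).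

Lemma is_derive_continuous f (t l : R) : is_derive t 1 f l -> {for t, continuous f}.
Proof.
move=> D; apply: differentiable_continuous; apply/derivable1_diffP.
exact: (@ex_derive _ _ _ _ _ _ _ D).
Qed.

Lemma dpath_cst T (c : R) : dpath T (fun=> c) (fun=> 0).
Proof. by split=> [|t _ _]; [exact: cvg_cst|exact: is_derive_cst]. Qed.

Lemma dpathD T f df g dg : dpath T f df -> dpath T g dg ->
  dpath T (fun t => f t + g t) (fun t => df t + dg t).
Proof.
move=> [cf Df] [cg Dg]; split; first exact: cvgD.
by move=> t t0 tT; apply: is_deriveD; [exact: Df|exact: Dg].
Qed.

Lemma dpathN T f df : dpath T f df -> dpath T (fun t => - f t) (fun t => - df t).
Proof.
move=> [cf Df]; split; first exact: cvgN.
by move=> t t0 tT; apply: is_deriveN; exact: Df.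
Qed.

Lemma dpathM T f df g dg : dpath T f df -> dpath T g dg ->
  dpath T (fun t => f t * g t) (fun t => df t * g t + f t * dg t).
Proof.
move=> [cf Df] [cg Dg]; split; first exact: cvgM.
move=> t t0 tT; have := is_deriveM (Df t t0 tT) (Dg t t0 tT).
by move=> /is_derive_eq; apply; rewrite addrC [g t *: _]mulrC.
Qed.

Lemma dpath_sum T (I : finType) (f df : I -> R -> R) :
  (forall i, dpath T (f i) (df i)) ->
  dpath T (fun t => \sum_i f i t) (fun t => \sum_i df i t).
Proof.
move=> H; have E k (u : I -> R -> R) : (fun t => \sum_(i <- k) u i t) = \sum_(i <- k) u i.
  by apply/funext => t; rewrite fct_sumE.
rewrite !E; elim: (index_enum I) => [|i s IH].
  by rewrite !big_nil; exact: dpath_cst.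
by rewrite !big_cons; exact: dpathD (H i) IH.
Qed.

Lemma dpath_eq T f df dg : dpath T f df ->
  (forall t, 0 < t -> (t%:E < T)%E -> df t = dg t) -> dpath T f dg.
Proof.
move=> [cf Df] E; split => // t t0 tT.
by apply: is_derive_eq; [exact: Df|exact: E].
Qed.

Lemma dpath_expR T (c : R) : dpath T (fun t => expR (c * t)) (fun t => c * expR (c * t)).
Proof.
have D (t : R) : is_derive t 1 (fun t => expR (c * t)) (c * expR (c * t)).
  have := @is_derive1_comp _ expR (fun t => c * t) t _ _ (is_derive_expR _)
    (@is_deriveZ _ _ _ id c t 1 1 (is_derive_id t 1)).
  by move=> /is_derive_eq; apply; rewrite [c *: 1]mulr1 mulrC.
split=> [|t _ _]; last exact: D.
by apply: cvg_at_right_filter; exact: (is_derive_continuous (D 0)).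
Qed.

(** This is the mean value theorem on [[a, b]]; the right continuity contained in [dpath] supplies
    continuity at the left end when [a = 0]. *)
Lemma dpath_le T f df a b : dpath T f df -> 0 <= a -> a <= b -> (b%:E < T)%E ->
  (forall t, a < t -> t < b -> 0 <= df t) -> f a <= f b.
Proof.
move=> [cf Df] a0; rewrite le_eqVlt => /predU1P[-> //|ab] bT H.
have cont t : 0 < t -> t <= b -> {for t, continuous f}.
  move=> t0 tb; apply: (is_derive_continuous (Df t t0 _)).
  by apply: le_lt_trans bT; rewrite lee_fin.
have [||c /[!in_itv]/= /andP[ac cb] E] := @MVT _ f df a b ab.
- move=> t /[!in_itv]/= /andP[at_ tb]; apply: Df; first exact: le_lt_trans at_.
  by apply: lt_trans bT; rewrite lte_fin.
- apply/(continuous_within_itvP _ ab); split.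
  + move=> t /[!in_itv]/= /andP[at_ tb].
    by apply: cont; [exact: le_lt_trans at_|exact: ltW].
  + move: a0; rewrite le_eqVlt => /predU1P[<- //|a0].
    by apply: cvg_at_right_filter; apply: cont => //; exact: ltW.
  + by apply: cvg_at_left_filter; apply: cont => //; exact: le_lt_trans ab.
by rewrite -subr_ge0 E mulr_ge0 ?subr_ge0 ?(ltW ab)// H.
Qed.

(** Both [g - f] and [g + f] are nondecreasing. A general comparison function [g], and not just a
    linear one, is needed for the exponential weight of the Picard iteration. *)
Lemma dpath_norm_le T f df g dg a b : dpath T f df -> dpath T g dg ->
  0 <= a -> a <= b -> (b%:E < T)%E ->
  (forall t, a < t -> t < b -> `|df t| <= dg t) -> `|f b - f a| <= g b - g a.
Proof.
move=> Df Dg a0 ab bT H.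
have : g a + - f a <= g b + - f b.
  apply: (dpath_le (dpathD Dg (dpathN Df))) => // t at_ tb.
  by rewrite subr_ge0; apply: le_trans (H _ at_ tb); exact: ler_norm.
have : g a + f a <= g b + f b.
  apply: (dpath_le (dpathD Dg Df)) => // t at_ tb.
  have := H _ at_ tb; rewrite ler_norml => /andP[+ _]; lra.
by move=> h1 h2; rewrite ler_norml; apply/andP; split; lra.
Qed.

Lemma dpath_id T : dpath T id (fun=> 1).
Proof.
split=> [|t _ _]; last exact: is_derive_id.
exact: cvg_at_right_filter.
Qed.

Lemma dpath_lip T f df (K : R) a b : dpath T f df -> 0 <= a -> a <= b -> (b%:E < T)%E ->
  (forall t, a < t -> t < b -> `|df t| <= K) -> `|f b - f a| <= K * (b - a).
Proof.
move=> Df a0 ab bT H; rewrite mulrBr.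
apply: (dpath_norm_le Df (dpathM (dpath_cst T K) (dpath_id T))) => // t at_ tb.
by rewrite mul0r add0r mulr1; exact: H.
Qed.

Lemma dpath_const T f df b : dpath T f df -> 0 <= b -> (b%:E < T)%E ->
  (forall t, 0 < t -> t < b -> df t = 0) -> f b = f 0.
Proof.
move=> Df b0 bT H; apply/eqP; rewrite -subr_eq0 -normr_le0.
have := dpath_lip (K := 0) Df (lexx 0) b0 bT; rewrite mul0r; apply.
by move=> t t0 tb; rewrite H// normr0.
Qed.

(** The product [f t * expR (- K * t)] is nonincreasing and starts at 0. *)
Lemma gronwall0 T f df (K : R) b : dpath T f df -> 0 <= b -> (b%:E < T)%E ->
  f 0 = 0 -> (forall t, 0 < t -> t < b -> df t <= K * f t) -> f b <= 0.
Proof.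
move=> Df b0 bT f0 H.
have := dpath_le (dpathN (dpathM Df (dpath_expR T (- K)))) (lexx 0) b0 bT.
rewrite f0 mul0r oppr0 => /(_ _)/wrap[|].
  move=> t t0 tb; have := H _ t0 tb; have := expR_gt0 (- K * t).
  set e := expR _ => e0 h.
  have -> : - (df t * e + f t * (- K * e)) = (K * f t - df t) * e by ring.
  by rewrite mulr_ge0 ?subr_ge0// ltW.
by rewrite oppr_ge0 pmulr_lle0 ?expR_gt0.
Qed.

(** Being monotone and bounded, [f] increases by less than any prescribed amount after a suitable
    time. A value of [df] at least [e] there would, by the Lipschitz bound, keep [df] above [e / 2]
    for a duration [eta] and make [f] increase by [eta * (e / 2)]. *)
Lemma barbalat f df (B K : R) : dpath +oo f df ->
  (forall t, 0 <= t -> f t <= B) ->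
  (forall t, 0 < t -> 0 <= df t) ->
  (forall s t, 0 < s -> s <= t -> `|df t - df s| <= K * (t - s)) ->
  forall e, 0 < e -> exists2 S, 0 < S & forall t, S <= t -> df t < e.
Proof.
move=> Df fB df0 dfK e e0.
pose K1 := `|K| + 1; have K10 : 0 < K1 by rewrite ltr_wpDl.
pose A := [set f t | t in [set t | 0 < t]].
have supA : has_sup A.
  split; first by exists (f 1), 1 => //=.
  by exists B => _ [t /= t0 <-]; exact/fB/ltW.
pose eta := e / (2 * K1); have eta0 : 0 < eta by rewrite divr_gt0 ?mulr_gt0.
have d0 : 0 < eta * (e / 2) by apply: mulr_gt0 => //; exact: divr_gt0.
have [_ [S /= S0 <-] fS] := sup_adherent d0 supA.
exists S => // t St; rewrite ltNge; apply/negP => et.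
have t0 : 0 < t by exact: lt_le_trans St.
have lty (s : R) : (s%:E < +oo)%E by exact: ltry.
have fSt : f S <= f t.
  apply: (dpath_le Df) => //; first exact: ltW.
  by move=> s Ss _; apply: df0; exact: lt_trans Ss.
have : f (t + eta) <= sup A.
  by apply: ub_le_sup; [case: supA|exists (t + eta) => //=; rewrite addr_gt0].
suff : eta * (e / 2) <= f (t + eta) - f t by lra.
have := dpath_le (dpathD Df (dpathN (dpathM (dpath_cst _ (e/2)) (dpath_id _)))) (ltW t0)
  (_ : t <= t + eta) (lty _).
rewrite lerDl (ltW eta0) => /(_ isT) /(_ _)/wrap[|]; last first.
  by rewrite /= -(_ : - (e / 2 * t) + e / 2 * (t + eta) = eta * (e / 2)); [lra|ring].
move=> s ts st; rewrite mul0r mulr1 add0r.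
have /= := dfK _ _ t0 (ltW ts).
have : K * (s - t) <= e / 2.
  apply: (@le_trans _ _ (K1 * eta)); last first.
    by rewrite /eta invfM mulrCA (mulrA K1) (mulrAC K1) divff ?gt_eqF// mul1r mulrC.
  apply: (@le_trans _ _ (K1 * (s - t))).
    apply: ler_wpM2r; first by rewrite subr_ge0 ltW.
    by apply: (le_trans (ler_norm _)); rewrite lerDl.
  by rewrite ler_pM2l//; lra.
by rewrite ler_norml => h /andP[h1 h2]; lra.
Qed.

End Differentiable_paths.

(** * Global solutions of bounded Lipschitz differential equations *)

Section Limits.
Context {R : realType}.

Lemma ler_addgeo (x y c : R) : (forall n, x <= y + c / 2 ^+ n) -> x <= y.
Proof.
move=> H; apply/ler_addgt0Pr => e e0.
have [n cn] : exists n, c / 2 ^+ n <= e.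
  have := archi_boundP (divr_ge0 (normr_ge0 c) (ltW e0)).
  set m := Num.bound _ => ltm; exists m.
  rewrite ler_pdivrMr ?exprn_gt0//; apply: (le_trans (ler_norm _)).
  rewrite mulrC -ler_pdivrMr//; apply: ltW; apply: (lt_le_trans ltm).
  by rewrite -natrX ler_nat ltnW// ltn_expl.
by apply: le_trans (H n) _; rewrite lerD2l.
Qed.

(** The tail of the geometric series from [n] on is [2 * c / 2 ^+ n], so the intervals of this
    radius around [u n] are nested; the limit is the supremum of their left ends. *)
Lemma geometric_limit (u : nat -> R) (c : R) :
  (forall n, `|u n.+1 - u n| <= c / 2 ^+ n) ->
  exists l, forall n, `|u n - l| <= 2 * c / 2 ^+ n.
Proof.
move=> H.
pose a n := u n - 2 * c / 2 ^+ n; pose b n := u n + 2 * c / 2 ^+ n.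
have c0 : 0 <= c by have := le_trans (normr_ge0 _) (H 0); rewrite expr0 divr1.
have E n : 2 * c / 2 ^+ n = 2 * c / 2 ^+ n.+1 + c / 2 ^+ n.
  by rewrite exprS; field; rewrite expf_neq0// pnatr_eq0.
have aS : nondecreasing_seq a.
  apply/nondecreasing_seqP => n; rewrite /a.
  by have := H n; have := E n; rewrite ler_norml => ? /andP[? ?]; lra.
have bS : nonincreasing_seq b.
  apply/nonincreasing_seqP => n; rewrite /b.
  by have := H n; have := E n; rewrite ler_norml => ? /andP[? ?]; lra.
have cn0 n : 0 <= 2 * c / 2 ^+ n by rewrite divr_ge0 ?mulr_ge0 ?exprn_ge0.
have ab m n : a m <= b n.
  apply: (le_trans (aS _ _ (leq_maxl m n))); apply: le_trans (bS _ _ (leq_maxr m n)).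
  by rewrite /a /b; have := cn0 (maxn m n); lra.
exists (sup (range a)) => n.
have h1 : a n <= sup (range a).
  by apply: ub_le_sup; [exists (b 0) => _ [m _ <-]|exists n].
have h2 : sup (range a) <= b n.
  by apply: ge_sup; [exists (a 0), 0 | move=> _ [m _ <-]].
by move: h1 h2; rewrite /a /b ler_norml => ? ?; apply/andP; split; lra.
Qed.

Lemma lipschitz_continuous (h : R -> R) (K : R) :
  (forall s t, `|h s - h t| <= K * `|s - t|) -> continuous h.
Proof.
move=> H t; apply/cvgrPdist_le => /= e e0.
pose K1 := `|K| + 1; have K10 : 0 < K1 by rewrite ltr_wpDl.
near=> s; apply: (le_trans (H _ _)).
apply: (@le_trans _ _ (K1 * (e / K1))); last by rewrite mulrC divfK// gt_eqF.
apply: (@le_trans _ _ (K1 * `|t - s|)).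
  by rewrite ler_wpM2r//; apply: (le_trans (ler_norm _)); rewrite lerDl.
rewrite ler_pM2l//; near: s; apply: cvgr_dist_le; first exact: cvg_id.
by rewrite divr_gt0.
Unshelve. all: by end_near. Qed.

Lemma maxr_lipschitz (c x y : R) : `|Num.max c x - Num.max c y| <= `|x - y|.
Proof.
have := ler_norm (x - y); have := ler_norm (y - x); rewrite distrC.
by case: (leP c x) => ?; case: (leP c y) => ?; rewrite ler_norml; lra.
Qed.

(* The base point -1 makes the primitive differentiable on a neighbourhood of 0. *)
Definition primitive (h : R -> R) (t : R) : R :=
  parameterized_integral lebesgue_measure (-1) t h -
  parameterized_integral lebesgue_measure (-1) 0 h.

Lemma primitive0 h : primitive h 0 = 0.
Proof. exact: subrr. Qed.

Lemma is_derive_primitive (h : R -> R) (t : R) : continuous h -> -1 < t ->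
  is_derive t 1 (primitive h) (h t).
Proof.
move=> ch t1.
have tt1 : t < t + 1 by rewrite ltrDl.
have inth : lebesgue_measure.-integrable `[-1, t + 1] (EFin \o h).
  apply: continuous_compact_integrable; first exact: segment_compact.
  exact: continuous_subspaceT.
have [dh dhE] := continuous_FTC1_closed tt1 inth t1 (ch t).
have D : is_derive t 1 (fun x => parameterized_integral lebesgue_measure (-1) x h) (h t).
  by split=> //; rewrite -dhE derive1E.
rewrite -[h t]subr0; apply: is_deriveB D _; exact: is_derive_cst.
Qed.

Lemma dpath_primitive (h : R -> R) : continuous h -> dpath +oo (primitive h) h.
Proof.
move=> ch; split=> [|t t0 _].
  apply: cvg_at_right_filter; apply: is_derive_continuous (is_derive_primitive ch _).
  by rewrite ltrN10.
by apply: is_derive_primitive => //; apply: lt_trans t0; rewrite ltrN10.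
Qed.

End Limits.

Section Picard.
Context {R : realType} {I : finType}.
Variables (F : (I -> R) -> I -> R) (B L : R).
Hypothesis F_bounded : forall y i, `|F y i| <= B.
Hypothesis F_lipschitz :
  forall y z i, `|F y i - F z i| <= L * \sum_j `|y j - z j|.
Variable y0 : I -> R.

Let B0 (i : I) : 0 <= B.
Proof. exact: le_trans (normr_ge0 _) (F_bounded (fun=> 0) i). Qed.

Let lip (y : R -> I -> R) := forall i (s t : R), 0 <= s -> 0 <= t ->
  `|y s i - y t i| <= B * `|s - t|.

(** Paths are controlled for nonnegative times only; freezing them before 0 gives an integrand
    continuous on the whole line, as [primitive] requires. *)
Let rhs (y : R -> I -> R) i (t : R) := F (y (Num.max t 0)) i.

Let picard (y : R -> I -> R) t i := y0 i + primitive (rhs y i) t.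

Let rhs_continuous y i : lip y -> continuous (rhs y i).
Proof.
move=> Ly; apply: (@lipschitz_continuous R _ (`|L| * (B *+ #|I|))) => s t.
apply: (le_trans (F_lipschitz _ _ _)).
apply: (@le_trans _ _ (`|L| * \sum_j `|y (Num.max s 0) j - y (Num.max t 0) j|)).
  by rewrite ler_wpM2r ?ler_norm// sumr_ge0.
rewrite -mulrA ler_wpM2l// mulrnAl -sumr_const ler_sum// => j _.
apply: (le_trans (Ly _ _ _ _ _)); rewrite ?le_max ?lexx ?orbT//.
by rewrite ler_wpM2l ?(B0 i)// ![Num.max _ 0]maxC maxr_lipschitz.
Qed.

Let picard_dpath y i : lip y -> dpath +oo (fun t => picard y t i) (rhs y i).
Proof.
move=> Ly.
have := dpathD (dpath_cst _ (y0 i)) (dpath_primitive (rhs_continuous (i := i) Ly)).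
by move=> /dpath_eq; apply => t _ _; rewrite add0r.
Qed.

Let picard_lip y : lip y -> lip (picard y).
Proof.
move=> Ly i s t; wlog st : s t / t <= s.
  move=> H s0 t0; have [ts|/ltW st] := leP t s; first exact: H.
  by rewrite distrC [`|s - t|]distrC; exact: H.
move=> s0 t0; rewrite [`|s - t|]ger0_norm ?subr_ge0//.
by apply: (dpath_lip (picard_dpath i Ly) t0 st (ltry _)) => ? _ _; exact: F_bounded.
Qed.

(** The summand 1 allows division by [2 * K] and, through [1 <= K], lets [expR (2 * K * t)] dominate
    [t] in the first Picard step. *)
Let K := #|I|%:R * `|L| + 1.

Let K_ge1 : 1 <= K.
Proof. by rewrite /K lerDr mulr_ge0. Qed.

(* With the weight [expR (2 * K * t)] the Picard operator contracts by 1/2 on the whole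
   half-line. *)
Let picard_contracts y z (c : R) : lip y -> lip z -> 0 <= c ->
  (forall t, 0 <= t -> \sum_i `|y t i - z t i| <= c * expR (2 * K * t)) ->
  forall t, 0 <= t ->
    \sum_i `|picard y t i - picard z t i| <= c / 2 * expR (2 * K * t).
Proof.
move=> Ly Lz c0 H t t0.
have K0 : 0 < K := lt_le_trans ltr01 K_ge1.
have step i : `|picard y t i - picard z t i| <= `|L| * c / (2 * K) * expR (2 * K * t).
  have D := dpathD (picard_dpath i Ly) (dpathN (picard_dpath i Lz)).
  have E := dpathM (dpath_cst +oo (`|L| * c / (2 * K))) (dpath_expR +oo (2 * K)).
  have := dpath_norm_le D E (lexx 0) t0 (ltry _).
  rewrite /picard !primitive0 subrr subr0 => /(_ _)/wrap[|].
    move=> s s0 st; rewrite mul0r add0r mulrA divfK ?mulf_neq0 ?(gt_eqF K0)//.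
    rewrite -mulrA; apply: (le_trans (F_lipschitz _ _ _)).
    apply: (@le_trans _ _ (`|L| * \sum_j `|y s j - z s j|)).
      by rewrite (max_idPl (ltW s0)) ler_wpM2r ?ler_norm// sumr_ge0.
    by rewrite ler_wpM2l// H// ltW.
  move=> /le_trans; apply; rewrite lerBlDr lerDl mulr_ge0 ?expR_ge0//.
  by rewrite divr_ge0 ?mulr_ge0 ?(ltW K0).
apply: (le_trans (ler_sum _ (fun i _ => step i))).
rewrite sumr_const -[leLHS]mulr_natl mulrA ler_wpM2r ?expR_ge0//.
rewrite !mulrA ler_pdivrMr ?mulr_gt0//.
rewrite (_ : c / 2 * (2 * K) = K * c); last by field.
by rewrite ler_wpM2r// /K lerDl.
Qed.

Let phi n := iter n picard (fun=> y0).

Let phi_lip n : lip (phi n).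
Proof.
elim: n => [|n IH]; last exact: picard_lip.
by move=> i s t _ _; rewrite subrr normr0 mulr_ge0// (B0 i).
Qed.

Let C := #|I|%:R * `|B|.

Let phi_step n t : 0 <= t ->
  \sum_i `|phi n.+1 t i - phi n t i| <= C / 2 ^+ n * expR (2 * K * t).
Proof.
elim: n t => [|n IH] t t0; last first.
  rewrite exprSr invfM mulrA; apply: (picard_contracts (phi_lip _) (phi_lip _) _ IH t0).
  by rewrite divr_ge0 ?exprn_ge0 ?mulr_ge0.
rewrite expr0 divr1 /C -mulrA mulr_natl -sumr_const ler_sum// => i _.
have E : phi 0 t i = phi 1 0 i by rewrite /= /picard primitive0 addr0.
rewrite E; apply: (le_trans (phi_lip 1 i t0 (lexx 0))).
rewrite subr0 (ger0_norm t0) ler_pM ?(B0 i) ?ler_norm//.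
apply: le_trans (expR_ge1Dx _); have := K_ge1 => K1.
by have := ler_wpM2r t0 K1; lra.
Qed.

Lemma ode_global_existence : exists y : R -> I -> R,
  [/\ y 0 = y0, forall i, dpath +oo (fun t => y t i) (fun t => F (y t) i) &
      forall i s t, 0 <= s -> 0 <= t -> `|y s i - y t i| <= B * `|s - t|].
Proof.
pose c t := C * expR (2 * K * t).
have phi_cvg (t : R) i : exists l : R, 0 <= t -> forall n, `|phi n t i - l| <= 2 * c t / 2 ^+ n.
  have [t0|] := leP 0 t; last by exists 0.
  have [|l ll] := @geometric_limit R (fun n => phi n t i) (c t); last by exists l.
  move=> n; rewrite /c mulrAC; apply: le_trans (phi_step n t0).
  by rewrite (bigD1 i)//= lerDl sumr_ge0.
have [y yP] : {y : R -> I -> R & forall t i, 0 <= t ->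
    forall n, `|phi n t i - y t i| <= 2 * c t / 2 ^+ n}.
  apply: (@choice _ _ (fun t (f : I -> R) => forall i, 0 <= t ->
    forall n, `|phi n t i - f i| <= 2 * c t / 2 ^+ n)) => t.
  by have [f fP] := choice (phi_cvg t); exists f.
(* The Lipschitz bound [B] is common to all iterates, hence passes to the pointwise limit; it is
   what allows the Picard operator to be applied to [y]. *)
have y_lip : lip y.
  move=> i s t s0 t0; apply: (@ler_addgeo _ _ _ (2 * c s + 2 * c t)) => n.
  have := yP s i s0 n; have := yP t i t0 n; have := phi_lip n i s0 t0.
  by rewrite !ler_norml mulrDl => /andP[? ?] /andP[? ?] /andP[? ?]; lra.
have fixpoint t i : 0 <= t -> picard y t i = y t i.
  move=> t0; apply/eqP; rewrite -subr_eq0 -normr_le0.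
  pose c' s := #|I|%:R * c s.
  apply: (@ler_addgeo _ _ _ (c' t + c t)) => n.
  have c0 s : 0 <= c s by rewrite /c /C !mulr_ge0 ?expR_ge0.
  have H s : 0 <= s -> \sum_j `|y s j - phi n s j| <= #|I|%:R * (2 * C) / 2 ^+ n * expR (2 * K * s).
    move=> s0; rewrite -!mulrA [(2 ^+ n)^-1 * _]mulrC !mulrA -!mulrA mulr_natl -sumr_const.
    apply: ler_sum => j _; rewrite distrC; have := yP s j s0 n.
    by rewrite /c !mulrA.
  have cn0 : 0 <= #|I|%:R * (2 * C) / 2 ^+ n.
    by rewrite divr_ge0 ?exprn_ge0 ?mulr_ge0.
  have h1 := picard_contracts y_lip (phi_lip n) cn0 H t0.
  have {h1}h1 : `|picard y t i - phi n.+1 t i| <= c' t / 2 ^+ n.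
    rewrite (_ : c' t / _ = #|I|%:R * (2 * C) / 2 ^+ n / 2 * expR (2 * K * t)); last first.
      by rewrite /c' /c; field; rewrite expf_neq0// pnatr_eq0.
    by apply: le_trans h1; rewrite (bigD1 i)//= lerDl sumr_ge0.
  have h2 : `|phi n.+1 t i - y t i| <= c t / 2 ^+ n.
    apply: (le_trans (yP t i t0 n.+1)); rewrite exprS.
    rewrite le_eqVlt; apply/orP; left; apply/eqP.
    by field; rewrite expf_neq0// pnatr_eq0.
  have := ler_distD (phi n.+1 t i) (picard y t i) (y t i).
  by rewrite add0r mulrDl; lra.
(* [y] and [picard y] are known to agree for nonnegative times only. Taking the primitive as witness
   gives differentiability at once, and the two are exchanged inside [F] alone. *)
exists (picard y); split=> [|i|]; last exact: picard_lip.
  by apply/funext => i; rewrite /picard primitive0 addr0.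
apply: (dpath_eq (picard_dpath i y_lip)) => t t0 _; rewrite /rhs (max_idPl (ltW t0)).
by congr (F _ i); apply/funext => j; rewrite fixpoint// ltW.
Qed.

End Picard.

(** * Rotations of three-dimensional space *)

Section Three_dimensional_algebra.
Context {R : realType}.
Implicit Types (u v w x : 'cV[R]_3) (A Q : 'M[R]_3).

Lemma sum3E (V : nmodType) (F : 'I_3 -> V) : \sum_i F i = F 0 + F 1 + F 2.
Proof.
rewrite !big_ord_recl big_ord0 addr0 addrA; congr (_ + F _ + F _); exact/val_inj.
Qed.

Lemma ord3_ind (P : 'I_3 -> Prop) : P 0 -> P 1 -> P 2 -> forall i, P i.
Proof.
move=> P0 P1 P2 [[|[|[|//]]] Hi].
- by rewrite (_ : Ordinal Hi = 0)//; exact/val_inj.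
- by rewrite (_ : Ordinal Hi = 1)//; exact/val_inj.
- by rewrite (_ : Ordinal Hi = 2)//; exact/val_inj.
Qed.

Let addI3 : ((((0 + 1)%R = 1%R :> 'I_3) * ((1 + 1)%R = 2%R :> 'I_3) *
  ((2 + 1)%R = 0%R :> 'I_3)) * (((0 + 2)%R = 2%R :> 'I_3) *
  ((1 + 2)%R = 0%R :> 'I_3) * ((2 + 2)%R = 1%R :> 'I_3)))%type.
Proof. by do !split; exact/val_inj. Qed.

Lemma crossE u v :
  ((cross u v 0%R 0%R = (u 1 0 * v 2 0 - u 2 0 * v 1 0)%R) *
  (cross u v 1%R 0%R = (u 2 0 * v 0 0 - u 0 0 * v 2 0)%R) *
  (cross u v 2%R 0%R = (u 0 0 * v 1 0 - u 1 0 * v 0 0)%R))%type.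
Proof. by rewrite !mxE !addI3. Qed.

Lemma colP3 u v : u 0 0 = v 0 0 -> u 1 0 = v 1 0 -> u 2 0 = v 2 0 -> u = v.
Proof.
by move=> *; apply/matrixP => i j; rewrite [j]ord1; elim/ord3_ind: i.
Qed.

Lemma hatE u : (((hat u 0%R 0%R = (0)%R) * (hat u 0%R 1%R = (- u 2 0)%R) * (hat u 0%R 2%R = (u 1 0)%R)) *
  ((hat u 1%R 0%R = (u 2 0)%R) * (hat u 1%R 1%R = (0)%R) * (hat u 1%R 2%R = (- u 0 0)%R)) *
  ((hat u 2%R 0%R = (- u 1 0)%R) * (hat u 2%R 1%R = (u 0 0)%R) * (hat u 2%R 2%R = (0)%R)))%type.
Proof.
by do !split; rewrite mxE crossE !mxE /= ?mulr0 ?mulr1 ?subr0 ?sub0r.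
Qed.

Lemma tr_hat u : (hat u)^T = - hat u.
Proof.
apply/matrixP => i j; rewrite mxE [RHS]mxE.
by elim/ord3_ind: i; elim/ord3_ind: j; rewrite !hatE ?oppr0 ?opprK.
Qed.

Lemma mul_hat u v : hat u *m v = cross u v.
Proof. by apply: colP3; rewrite mxE sum3E !hatE crossE; ring. Qed.

Lemma det3E A : \det A =
  A 0 0 * (A 1 1 * A 2 2 - A 1 2 * A 2 1) - A 0 1 * (A 1 0 * A 2 2 - A 1 2 * A 2 0)
  + A 0 2 * (A 1 0 * A 2 1 - A 1 1 * A 2 0).
Proof.
(* With natural numbers as indices, the lifted ordinals of the cofactor expansion reduce by
   computation. *)
pose f (i j : nat) := A (inord i) (inord j).
have fE i j : A i j = f i j by rewrite /f !inord_val.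
rewrite (expand_det_row _ 0) sum3E /cofactor !(expand_det_row _ 0) !big_ord_recl !big_ord0.
rewrite /cofactor !det_mx11 !mxE !fE /= /bump /= !(expr0, expr1, expr2) /=.
rewrite (_ : 1 %% 3 = 1)%N// (_ : (1 + 1) %% 3 = 2)%N// !addn0 addn1; ring.
Qed.

Lemma mulmx_colE A u i :
  (A *m u) i 0 = A i 0 * u 0 0 + A i 1 * u 1 0 + A i 2 * u 2 0.
Proof. by rewrite mxE sum3E. Qed.

Lemma scale_colE a u i : (a *: u) i 0 = a * u i 0.
Proof. by rewrite mxE. Qed.

Lemma add_colE u v i : (u + v) i 0 = u i 0 + v i 0.
Proof. by rewrite mxE. Qed.

Lemma opp_colE u i : (- u) i 0 = - u i 0.
Proof. by rewrite mxE. Qed.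

Lemma trE A i j : A^T i j = A j i.
Proof. by rewrite mxE. Qed.

Let entryE := (mulmx_colE, scale_colE, add_colE, opp_colE, trE).

Definition dot u v : R := \sum_i u i 0 * v i 0.

Lemma dotE u v : dot u v = u 0 0 * v 0 0 + u 1 0 * v 1 0 + u 2 0 * v 2 0.
Proof. by rewrite /dot sum3E. Qed.

Lemma dotC u v : dot u v = dot v u.
Proof. by rewrite !dotE; ring. Qed.

Lemma dotDl u v w : dot (u + v) w = dot u w + dot v w.
Proof. by rewrite !dotE !entryE; ring. Qed.

Lemma dotDr u v w : dot u (v + w) = dot u v + dot u w.
Proof. by rewrite !dotE !entryE; ring. Qed.

Lemma dotZl a u v : dot (a *: u) v = a * dot u v.
Proof. by rewrite !dotE !entryE; ring. Qed.

Lemma dotZr a u v : dot u (a *: v) = a * dot u v.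
Proof. by rewrite !dotE !entryE; ring. Qed.

Lemma dotNl u v : dot (- u) v = - dot u v.
Proof. by rewrite !dotE !entryE; ring. Qed.

Lemma dotNr u v : dot u (- v) = - dot u v.
Proof. by rewrite !dotE !entryE; ring. Qed.

Lemma dot_suml (I : finType) (f : I -> 'cV[R]_3) v :
  dot (\sum_i f i) v = \sum_i dot (f i) v.
Proof.
rewrite /dot exchange_big /=; apply: eq_bigr => i _.
by rewrite summxE big_distrl.
Qed.

Lemma dot_sumr (I : finType) u (f : I -> 'cV[R]_3) :
  dot u (\sum_i f i) = \sum_i dot u (f i).
Proof. by rewrite dotC dot_suml; apply: eq_bigr => i _; rewrite dotC. Qed.

Lemma dot_ge0 u : 0 <= dot u u.
Proof. by rewrite dotE -!expr2 !addr_ge0 ?sqr_ge0. Qed.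

Lemma dot_eq0 u : dot u u = 0 -> u = 0.
Proof.
move=> /eqP; rewrite dotE -!expr2 !paddr_eq0 ?addr_ge0 ?sqr_ge0// !sqrf_eq0.
by move=> /andP[/andP[/eqP ? /eqP ?] /eqP ?]; apply: colP3; rewrite [RHS]mxE.
Qed.

(** Lagrange's identity, from which the Cauchy-Schwarz inequality follows. *)
Lemma dot_cross u v :
  dot (cross u v) (cross u v) = dot u u * dot v v - dot u v ^+ 2.
Proof. by rewrite !dotE !crossE; ring. Qed.

Lemma cauchy_schwarz u v : dot u v ^+ 2 <= dot u u * dot v v.
Proof. by rewrite -subr_ge0 -dot_cross dot_ge0. Qed.

Lemma cross_cross u v : cross (cross u v) u = dot u u *: v - dot u v *: u.
Proof. by apply: colP3; rewrite crossE !entryE !dotE !crossE; ring. Qed.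

Lemma dot_mul A u v : dot (A *m u) v = dot u (A^T *m v).
Proof. by rewrite !dotE !entryE; ring. Qed.

(** The cofactor identity, polynomial in the entries; for rotations it says that they commute with
    the cross product. *)
Lemma mul_tr_cross A u v : A^T *m cross (A *m u) (A *m v) = \det A *: cross u v.
Proof.
by apply: colP3; rewrite !entryE !crossE !entryE det3E; ring.
Qed.

Lemma SO3_tr_mul Q : SO3 Q -> Q^T *m Q = 1%:M. Proof. by case. Qed.

Lemma SO3_mul_tr Q : SO3 Q -> Q *m Q^T = 1%:M.
Proof. by case=> /mulmx1C. Qed.

Lemma SO3_dot Q u v : SO3 Q -> dot (Q *m u) (Q *m v) = dot u v.
Proof. by move=> sQ; rewrite dot_mul mulmxA SO3_tr_mul// mul1mx. Qed.

Lemma SO3_cross Q u v : SO3 Q -> cross (Q *m u) (Q *m v) = Q *m cross u v.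
Proof.
move=> sQ; rewrite -[LHS]mul1mx -(SO3_mul_tr sQ) -mulmxA mul_tr_cross.
by case: sQ => _ ->; rewrite scale1r.
Qed.

Lemma SO3_mul Q Q' : SO3 Q -> SO3 Q' -> SO3 (Q *m Q').
Proof.
move=> [h1 h2] [h3 h4]; split; last by rewrite det_mulmx h2 h4 mulr1.
by rewrite trmx_mul mulmxA -(mulmxA _ Q^T) h1 mulmx1.
Qed.

Lemma SO3_tr Q : SO3 Q -> SO3 Q^T.
Proof.
by move=> sQ; split; [rewrite trmxK SO3_mul_tr|rewrite det_tr; case: sQ].
Qed.

Lemma mul_e1 A i : (A *m e1) i 0 = A i 0.
Proof. by rewrite mxE sum3E !mxE /= mulr1 !mulr0 !addr0. Qed.

Lemma dot_e1 : dot e1 e1 = 1 :> R.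
Proof. by rewrite dotE !mxE /= mulr1 !mulr0 !addr0. Qed.

Lemma frobenius_ge0 m n (A : 'M[R]_(m, n)) : 0 <= frobenius A.
Proof. exact: sqrtr_ge0. Qed.

Lemma sqr_frobenius m n (A : 'M[R]_(m, n)) :
  frobenius A ^+ 2 = \sum_i \sum_j A i j ^+ 2.
Proof. by rewrite sqr_sqrtr// !sumr_ge0// => i _; rewrite sumr_ge0// => j _; rewrite sqr_ge0. Qed.

(* The witness is the rotation about the axis [e1 x v]. *)
Lemma rotation_of_e1 v : dot v v = 1 -> -1 < v 0 0 ->
  exists2 Q, SO3 Q /\ Q *m e1 = v & frobenius (Q - 1%:M) ^+ 2 = 4 * (1 - v 0 0).
Proof.
move=> v1 v0; set p := v 0 0 in v0 *; pose q := v 1 0; pose r := v 2 0.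
have p1 : 1 + p != 0 by rewrite gt_eqF// -ltrBlDl sub0r.
have E : r ^+ 2 = 1 - p ^+ 2 - q ^+ 2 by rewrite -v1 dotE /q /r /p; ring.
(* Rodrigues' formula [1 + hat w + (hat w)^2 / (1 + p)] for [w = cross e1 v], written out by
   entries. The hypothesis on [v 0 0] keeps the denominator away from 0. *)
pose a := 1 - q ^+ 2 / (1 + p); pose b := - (q * r) / (1 + p).
pose c := 1 - r ^+ 2 / (1 + p).
pose f (i j : 'I_3) := nth 0 (nth [::] [:: [:: p; - q; - r]; [:: q; a; b]; [:: r; b; c]] i) j.
pose Q := \matrix_(i < 3, j < 3) f i j.
have fE : (((f 0%R 0%R = (p)%R) * (f 0%R 1%R = (- q)%R) * (f 0%R 2%R = (- r)%R)) *
  ((f 1%R 0%R = (q)%R) * (f 1%R 1%R = (a)%R) * (f 1%R 2%R = (b)%R)) *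
  ((f 2%R 0%R = (r)%R) * (f 2%R 1%R = (b)%R) * (f 2%R 2%R = (c)%R)))%type.
  by [].
exists Q; first split; first split.
- apply/matrixP => i j; rewrite mxE sum3E ![Q^T _ _]mxE ![Q _ _]mxE.
  elim/ord3_ind: i; elim/ord3_ind: j; rewrite !mxE /= !fE /a /b /c; field: E => //.
- by rewrite det3E ![Q _ _]mxE !fE /a /b /c; field: E.
- by apply: colP3; rewrite mul_e1 mxE fE.
- have QE i j : (Q - 1%:M) i j = f i j - (i == j)%:R by rewrite !mxE.
  rewrite sqr_frobenius !sum3E !QE /= !fE.
  by rewrite /a /b /c; field: E.
Qed.

Lemma frobenius_SO3_mul m (Q : 'M[R]_3) (A : 'M[R]_(3, m)) : SO3 Q ->
  frobenius (Q *m A) = frobenius A.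
Proof.
move=> sQ; congr Num.sqrt; rewrite exchange_big [RHS]exchange_big /=.
apply: eq_bigr => j _.
have E (B : 'M[R]_(3, m)) : \sum_i B i j ^+ 2 = dot (col j B) (col j B).
  by apply: eq_bigr => i _; rewrite mxE expr2.
by rewrite !E -(SO3_dot (col j A) _ sQ) !colE mulmxA.
Qed.

(* [Q' = Q *m S] where [S] rotates [e1] to [Q^T *m v]. *)
Lemma rotate_to Q v : SO3 Q -> dot v v = 1 -> -1 < dot (Q *m e1) v ->
  exists2 Q', SO3 Q' /\ Q' *m e1 = v &
    frobenius (Q - Q') ^+ 2 = 4 * (1 - dot (Q *m e1) v).
Proof.
move=> sQ v1; have E : dot (Q *m e1) v = (Q^T *m v) 0 0.
  by rewrite dot_mul dotE !mxE /= mul1r !mul0r !addr0.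
rewrite E => v0; have [|S [sS Se1] Sf] := rotation_of_e1 _ v0.
  by rewrite (SO3_dot _ _ (SO3_tr sQ)).
exists (Q *m S); first split; first exact: SO3_mul.
  by rewrite -mulmxA Se1 mulmxA SO3_mul_tr// mul1mx.
rewrite -Sf -(frobenius_SO3_mul (S - 1%:M) sQ) mulmxBr mulmx1 -opprB.
congr (_ ^+ 2); congr Num.sqrt; apply: eq_bigr => i _; apply: eq_bigr => j _.
by rewrite mxE sqrrN.
Qed.

End Three_dimensional_algebra.

(** * Entrywise derivatives and limits of matrix paths *)

Section Matrix_paths.
Context {R : realType}.

Lemma is_derive_mxP m n (M : R -> 'M[R]_(m, n)) (t : R) (D : 'M[R]_(m, n)) :
  is_derive t 1 M D <-> forall i j, is_derive t 1 (fun s => M s i j) (D i j).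
Proof.
split=> [[dM <-] i j|H].
  by split; [exact: ((derivable_mxP M t 1).1 dM i j)|rewrite derive_mx// mxE].
have dM : derivable M t 1 by apply/derivable_mxP => i j; case: (H i j).
split=> //; rewrite derive_mx//; apply/matrixP => i j; rewrite mxE.
by case: (H i j).
Qed.

Lemma cvg_mxP m n (M : R -> 'M[R]_(m, n)) (F : set_system R) (L : 'M[R]_(m, n)) :
  Filter F -> M @ F --> L <-> forall i j, (fun s => M s i j) @ F --> L i j.
Proof.
move=> FF; split=> [H i j|H].
  exact: (cvg_comp _ _ H (@coord_continuous _ _ _ i j L)).
apply/cvgrPdist_le => /= e e0.
have H' : \forall t \near F, forall ij : 'I_m * 'I_n, `|L ij.1 ij.2 - M t ij.1 ij.2| <= e.
  by apply: filter_forall => -[i j]; have /cvgrPdist_le := H i j; apply.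
apply: filterS H' => t Ht.
rewrite /Num.Def.normr/= mx_normrE (bigmax_le _ (ltW e0))//= => i _.
by rewrite !mxE; exact: Ht.
Qed.

End Matrix_paths.

(** * Calculus of bounded Lipschitz functions *)

Section Bounded_lipschitz.
Context {R : realType} {I : finType}.
Implicit Types f g : (I -> R) -> R.

(** Boundedness is carried along because Lipschitz functions alone are not closed under products;
    once the entries are clipped, every polynomial in them belongs to this class. *)
Definition bdlip f := exists B L, [/\ 0 <= L, forall y, `|f y| <= B &
  forall y z, `|f y - f z| <= L * \sum_i `|y i - z i|].

Lemma bdlip_cst (c : R) : bdlip (fun=> c).
Proof. by exists `|c|, 0; split=> // y z; rewrite subrr normr0 mul0r. Qed.

Lemma bdlipD f g : bdlip f -> bdlip g -> bdlip (fun y => f y + g y).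
Proof.
move=> [B [L [L0 fB fL]]] [B' [L' [L'0 gB gL]]]; exists (B + B'), (L + L').
split=> [|y|y z]; first exact: addr_ge0.
  by apply: (le_trans (ler_normD _ _)); exact: lerD.
rewrite opprD addrACA mulrDl; apply: (le_trans (ler_normD _ _)); exact: lerD.
Qed.

Lemma bdlipM f g : bdlip f -> bdlip g -> bdlip (fun y => f y * g y).
Proof.
move=> [B [L [L0 fB fL]]] [B' [L' [L'0 gB gL]]]; exists (B * B'), (B * L' + B' * L).
have B0 : 0 <= B := le_trans (normr_ge0 _) (fB (fun=> 0)).
have B'0 : 0 <= B' := le_trans (normr_ge0 _) (gB (fun=> 0)).
split=> [|y|y z]; first by rewrite addr_ge0 ?mulr_ge0.
  by rewrite normrM ler_pM.
rewrite (_ : f y * g y - f z * g z = f y * (g y - g z) + g z * (f y - f z)); last by ring.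
rewrite mulrDl -!mulrA; apply: (le_trans (ler_normD _ _)); rewrite !normrM.
by apply: lerD; apply: ler_pM.
Qed.

Lemma bdlipN f : bdlip f -> bdlip (fun y => - f y).
Proof.
move=> [B [L [L0 fB fL]]]; exists B, L; split=> // [y|y z]; first by rewrite normrN.
by rewrite -opprD normrN.
Qed.

Lemma bdlip_sum (J : finType) (f : J -> (I -> R) -> R) :
  (forall j, bdlip (f j)) -> bdlip (fun y => \sum_j f j y).
Proof.
move=> H; elim: (index_enum J) => [|j s IH].
  by under eq_fun do rewrite big_nil; exact: bdlip_cst.
by under eq_fun do rewrite big_cons; exact: bdlipD.
Qed.

Definition clip (x : R) : R := Num.max (- 2) (Num.min x 2).

Lemma clip_id x : `|x| <= 2 -> clip x = x.
Proof. by rewrite ler_norml /clip => /andP[? ?]; rewrite min_l// max_r. Qed.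

Lemma bdlip_clip i : bdlip (fun y => clip (y i)).
Proof.
exists 2, 1; split=> // [y|y z].
  by rewrite ler_norml /clip le_max lexx /= ge_max ge_min lexx orbT andbT; lra.
rewrite mul1r (bigD1 i)//=; apply: ler_wpDr; first exact: sumr_ge0.
apply: le_trans (maxr_lipschitz _ _ _) _.
have := ler_norm (y i - z i); have := ler_norm (z i - y i); rewrite distrC.
by case: (leP (y i) 2) => ?; case: (leP (z i) 2) => ?; rewrite ler_norml; lra.
Qed.

Definition bdlip_mx m n (A : (I -> R) -> 'M[R]_(m, n)) :=
  forall i j, bdlip (fun y => A y i j).

Lemma bdlip_mulmx m n p (A : (I -> R) -> 'M[R]_(m, n)) (B : (I -> R) -> 'M[R]_(n, p)) :
  bdlip_mx A -> bdlip_mx B -> bdlip_mx (fun y => A y *m B y).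
Proof.
move=> HA HB i j; under eq_fun do rewrite mxE.
by apply: bdlip_sum => k; exact: bdlipM.
Qed.

Lemma bdlip_cst_mx m n (A : 'M[R]_(m, n)) : bdlip_mx (fun=> A).
Proof. by move=> i j; exact: bdlip_cst. Qed.

Lemma bdlip_trmx m n (A : (I -> R) -> 'M[R]_(m, n)) :
  bdlip_mx A -> bdlip_mx (fun y => (A y)^T).
Proof. by move=> HA i j; under eq_fun do rewrite mxE; exact: HA. Qed.

Lemma bdlip_scale_sum (J : finType) m n c (A : J -> (I -> R) -> 'M[R]_(m, n)) :
  (forall j, bdlip_mx (A j)) -> bdlip_mx (fun y => c *: \sum_j A j y).
Proof.
move=> HA i j; under eq_fun do rewrite mxE summxE.
by apply: bdlipM; [exact: bdlip_cst|apply: bdlip_sum => k; exact: HA].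
Qed.

Lemma bdlip_cross (u v : (I -> R) -> 'cV[R]_3) :
  bdlip_mx u -> bdlip_mx v -> bdlip_mx (fun y => cross (u y) (v y)).
Proof.
move=> Hu Hv i j; under eq_fun do rewrite mxE.
by apply: bdlipD; [|apply: bdlipN]; apply: bdlipM.
Qed.

Lemma bdlip_hat (u : (I -> R) -> 'cV[R]_3) :
  bdlip_mx u -> bdlip_mx (fun y => hat (u y)).
Proof.
move=> Hu i j; under eq_fun do rewrite mxE.
by apply: bdlip_cross => //; exact: bdlip_cst_mx.
Qed.

End Bounded_lipschitz.

(** * The closed-loop rotation dynamics *)

Section Rotation_dynamics.
Context {R : realType} {N : nat}.

Lemma bdlip_uniform (I : finType) (F : (I -> R) -> I -> R) :
  (forall i, bdlip (fun y => F y i)) -> exists B L,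
  [/\ 0 <= L, forall y i, `|F y i| <= B &
      forall y z i, `|F y i - F z i| <= L * \sum_j `|y j - z j|].
Proof.
move=> /choice[b /choice[l H]]; exists (\sum_i `|b i|), (\sum_i l i).
have l0 i : 0 <= l i by case: (H i).
split=> [|y i|y z i]; first exact: sumr_ge0.
  case: (H i) => _ + _ => /(_ y)/le_trans; apply.
  by rewrite (bigD1 i)//= ler_wpDr ?sumr_ge0 ?ler_norm.
case: (H i) => _ _ /(_ y z)/le_trans; apply.
by rewrite ler_wpM2r ?sumr_ge0// (bigD1 i)//= lerDl sumr_ge0.
Qed.

(** The derivative of [Q *m Q^T] vanishes because [hat (w t)] is skew-symmetric, that of the
    determinant because its trace is 0. The form of [D] is required between 0 and [b] only, so that
    the lemma applies to the truncated field on any interval where the truncation is inactive. *)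
Lemma SO3_conserved (Q D : R -> 'M[R]_3) (w : R -> 'cV[R]_3) (b : R) :
  (forall i j, dpath +oo (fun t => Q t i j) (fun t => D t i j)) ->
  0 <= b -> (forall t, 0 < t -> t < b -> D t = Q t *m hat (w t)) ->
  SO3 (Q 0) -> SO3 (Q b).
Proof.
move=> H b0 DE [Q0 detQ0]; split.
  apply: mulmx1C; rewrite -(mulmx1C Q0); apply/matrixP => i j.
  have E t : (Q t *m (Q t)^T) i j = \sum_l Q t i l * Q t j l.
    by rewrite mxE; apply: eq_bigr => l _; rewrite mxE.
  rewrite !E; apply: (dpath_const (dpath_sum (fun l => dpathM (H i l) (H j l)))) => //.
    exact: ltry.
  move=> t t0 tb.
  have -> : \sum_l (D t i l * Q t j l + Q t i l * D t j l) =
      (D t *m (Q t)^T + Q t *m (D t)^T) i j.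
    by rewrite big_split/= !mxE; congr (_ + _); apply: eq_bigr => l _; rewrite !mxE.
  rewrite DE// trmx_mul tr_hat mulNmx mulmxN -mulmxA subrr.
  by rewrite mxE.
rewrite -detQ0 !det3E.
pose q i j := H i j.
have dM a b c d := dpathD (dpathM (q a b) (q c d)).
have minor a b c d := dpathD (dpathM (q 1 a) (q 2 b)) (dpathN (dpathM (q 1 c) (q 2 d))).
have := dpath_const (dpathD (dpathD (dpathM (q 0 0) (minor 1 2 2 1))
  (dpathN (dpathM (q 0 1) (minor 0 2 2 0)))) (dpathM (q 0 2) (minor 0 1 1 0))) b0 (ltry _).
apply=> t t0 tb /=; rewrite DE// ![(_ *m _) _ _]mxE !sum3E !hatE; ring.
Qed.

Implicit Types Q : 'I_N -> 'M[R]_3.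

(** The control depends on the orientations alone. They therefore obey an autonomous equation,
    solved first; positions are recovered afterwards by integrating the headings. *)
Definition heading_average Q : 'cV[R]_3 := N%:R^-1 *: \sum_(j < N) Q j *m e1.

Definition turn Q (k : 'I_N) : 'cV[R]_3 :=
  (Q k)^T *m cross (Q k *m e1) (heading_average Q).

Definition spin Q (k : 'I_N) : 'M[R]_3 := Q k *m hat (turn Q k).

Let I : finType := ('I_N * 'I_3 * 'I_3)%type.

Let unpack (y : I -> R) (k : 'I_N) : 'M[R]_3 := \matrix_(i, j) y (k, i, j).

Let pack Q (i : I) : R := Q i.1.1 i.1.2 i.2.

Let clipped_spin (y : I -> R) : I -> R :=
  pack (spin (unpack (fun i => clip (y i)))).

Let bdlip_clipped_spin i : bdlip (fun y => clipped_spin y i).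
Proof.
case: i => [[k i] j].
have HQ l : bdlip_mx (fun y => unpack (fun i => clip (y i)) l).
  by move=> a b; under eq_fun do rewrite mxE; exact: bdlip_clip.
have Hx l : bdlip_mx (fun y => unpack (fun i => clip (y i)) l *m e1).
  by apply: bdlip_mulmx => //; exact: bdlip_cst_mx.
apply: (@bdlip_mulmx _ _ _ _ _ (fun y => unpack (fun i => clip (y i)) k)
  (fun y => hat (turn (unpack (fun i => clip (y i))) k))) => //.
apply: bdlip_hat; apply: bdlip_mulmx; first exact: bdlip_trmx.
by apply: bdlip_cross => //; exact: bdlip_scale_sum.
Qed.

Lemma SO3_entry (Q : 'M[R]_3) i j : SO3 Q -> `|Q i j| <= 1.
Proof.
move=> sQ; have := congr1 (fun A : 'M[R]_3 => A i i) (SO3_mul_tr sQ).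
rewrite mxE (bigD1 j)//= !mxE eqxx /= mulr1n => E.
have : Q i j ^+ 2 <= 1.
  rewrite -E expr2 lerDl sumr_ge0// => l _.
  by rewrite mxE -expr2 sqr_ge0.
by move=> h; rewrite -(@expr_le1 _ 2)// real_normK// num_real.
Qed.

Let clipped_spinE Q : (forall k i j, `|Q k i j| <= 2) ->
  clipped_spin (pack Q) = pack (spin Q).
Proof.
move=> H; rewrite /clipped_spin (_ : unpack _ = Q)//.
by apply/funext => k; apply/matrixP => i j; rewrite mxE clip_id//; exact: H.
Qed.

(** The Lipschitz bound in the conclusion makes the headings continuous, so that they can be
    integrated into positions. *)
Lemma rotations_exist Q0 : (forall k, SO3 (Q0 k)) ->
  exists (Q : R -> 'I_N -> 'M[R]_3) (B : R),
  [/\ Q 0 = Q0, forall t k, 0 <= t -> SO3 (Q t k),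
      forall k i j, dpath +oo (fun t => Q t k i j) (fun t => spin (Q t) k i j) &
      forall k i j s t, 0 <= s -> 0 <= t -> `|Q s k i j - Q t k i j| <= B * `|s - t|].
Proof.
move=> sQ0; have [B [L [L0 FB FL]]] := bdlip_uniform bdlip_clipped_spin.
have [y [y0 Dy yB]] := ode_global_existence FB FL (pack Q0).
pose Q t := unpack (y t).
have packQ t : pack (Q t) = y t.
  by apply/funext => -[[k i] j]; rewrite /pack mxE.
pose d := (`|B| + 1)^-1; have B1 : 0 < `|B| + 1 by rewrite ltr_wpDl.
have d0 : 0 < d by rewrite invr_gt0.
have Bd : `|B| * d <= 1 by rewrite ler_pdivrMr// mul1r lerDl.
have Q0E : Q 0 = Q0.
  by apply/funext => k; apply/matrixP => i j; rewrite mxE y0.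
(* The entries of a rotation are at most 1 and those of [y] move by at most 1 in time [d],
   so the clipping at 2 stays inactive for one more step. *)
have step n t k : 0 <= t -> t <= d *+ n -> SO3 (Q t k).
  elim: n t k => [|n IH] t k t0 tn.
    have -> : t = 0 by apply/eqP; rewrite eq_le t0 -[0](mulr0n d) tn.
    by rewrite Q0E.
  pose D s := \matrix_(i, j) clipped_spin (y s) (k, i, j) : 'M[R]_3.
  apply: (@SO3_conserved (Q ^~ k) D (fun s => turn (Q s) k)) => //.
  - move=> i j.
    rewrite (_ : (fun s => Q s k i j) = y ^~ (k, i, j)); last by apply/funext => s; rewrite mxE.
    by apply: (dpath_eq (Dy (k, i, j))) => s _ _; rewrite mxE.
  - move=> s s0 st; apply/matrixP => i j; rewrite mxE -packQ clipped_spinE// => l a b.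
    (* The latest time up to [s] that the induction hypothesis covers; it lies within [d] of [s]. *)
    pose s' := Num.min s (d *+ n).
    have s'0 : 0 <= s' by rewrite /s' le_min (ltW s0) mulrn_wge0// ltW.
    have ss' : `|s - s'| <= d.
      rewrite /s'; case: (leP s (d *+ n)) => h; first by rewrite subrr normr0 ltW.
      by move: tn; rewrite mulrS ger0_norm; lra.
    have := SO3_entry a b (IH _ l s'0 _); rewrite /s' ge_min lexx orbT => /(_ isT).
    have := yB (l, a, b) s s' (ltW s0) s'0; rewrite -/s' !mxE => h1 h2.
    have : B * `|s - s'| <= 1.
      apply: le_trans (ler_wpM2r (normr_ge0 _) (ler_norm B)) _.
      by apply: le_trans Bd; rewrite ler_wpM2l.
    have := ler_distD (y s' (l, a, b)) (y s (l, a, b)) 0; rewrite !subr0; lra.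
  by rewrite Q0E.
exists Q, B; split=> //.
- move=> t k t0; apply: (step (Num.bound (t / d))) => //.
  by rewrite -mulr_natr mulrC -ler_pdivrMr//; apply/ltW/archi_boundP/divr_ge0/ltW.
- move=> k i j.
  rewrite (_ : (fun s => Q s k i j) = y ^~ (k, i, j)); last by apply/funext => s; rewrite mxE.
  apply: (dpath_eq (Dy (k, i, j))) => t t0 _.
  rewrite -packQ clipped_spinE// => l a b; apply: le_trans (SO3_entry a b _) _.
    apply: (step (Num.bound (t / d))); first exact: ltW.
    by rewrite -mulr_natr mulrC -ler_pdivrMr//; apply/ltW/archi_boundP/divr_ge0/ltW => //; exact: ltW.
  by lra.
- by move=> k i j s t s0 t0; rewrite !mxE; exact: yB.
Qed.

(** Both paths stay among rotations, where the truncated Lipschitz field coincides with the true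
    one. The sum of the squared differences of the entries then satisfies a Gronwall inequality, by
    [2 |x| |y| <= x^2 + y^2]. *)
Lemma rotations_unique (T : \bar R) (Q Q' : R -> 'I_N -> 'M[R]_3) :
  (forall k i j, dpath T (fun t => Q t k i j) (fun t => spin (Q t) k i j)) ->
  (forall k i j, dpath T (fun t => Q' t k i j) (fun t => spin (Q' t) k i j)) ->
  (forall t k, 0 <= t -> (t%:E < T)%E -> SO3 (Q t k) /\ SO3 (Q' t k)) ->
  Q 0 = Q' 0 -> forall t, 0 <= t -> (t%:E < T)%E -> Q t = Q' t.
Proof.
move=> HQ HQ' sQ QQ' b b0 bT.
have [B [L [L0 _ FL]]] := bdlip_uniform bdlip_clipped_spin.
pose d t i := pack (Q t) i - pack (Q' t) i.
pose dd t i := pack (spin (Q t)) i - pack (spin (Q' t)) i.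
have Dd i : dpath T (d ^~ i) (dd ^~ i).
  exact: dpathD (HQ i.1.1 i.1.2 i.2) (dpathN (HQ' i.1.1 i.1.2 i.2)).
have De := dpath_sum (fun i => dpathM (Dd i) (Dd i)).
have : \sum_i d b i * d b i <= 0.
  apply: (gronwall0 (K := 2 * L * #|I|%:R) De) => //.
    by apply: big1 => i _; rewrite /d QQ' subrr mul0r.
  move=> t t0 tb.
  have tT : (t%:E < T)%E by apply: lt_trans bT; rewrite lte_fin.
  have ddL i : `|dd t i| <= L * \sum_j `|d t j|.
    rewrite /dd -!clipped_spinE; first exact: FL.
      by move=> k a c; apply: le_trans (SO3_entry _ _ (sQ t k (ltW t0) tT).2) _; lra.
    by move=> k a c; apply: le_trans (SO3_entry _ _ (sQ t k (ltW t0) tT).1) _; lra.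
  apply: (@le_trans _ _ (\sum_i \sum_j L * (d t i * d t i + d t j * d t j))).
    apply: ler_sum => i _; rewrite -mulr_sumr.
    apply: (@le_trans _ _ (2 * `|d t i| * `|dd t i|)).
      by rewrite mulrC -mulrDl mulrC -mulrA -normrM; have := ler_norm (d t i * dd t i); lra.
    apply: (@le_trans _ _ (2 * `|d t i| * (L * \sum_j `|d t j|))).
      by rewrite ler_wpM2l// mulr_ge0.
    rewrite mulrCA ler_wpM2l// mulr_sumr ler_sum// => j _.
    have := sqr_ge0 (`|d t i| - `|d t j|).
    by rewrite sqrrB !real_normK ?num_real// !expr2; lra.
  under eq_bigr do rewrite -mulr_sumr big_split/= sumr_const.
  rewrite -mulr_sumr big_split/= sumr_const sumrMnl.
  rewrite -[_ *+ #|_|]mulr_natr le_eqVlt; apply/orP; left; apply/eqP; ring.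
rewrite le_eqVlt ltNge sumr_ge0 ?orbF; last by move=> i _; rewrite -expr2 sqr_ge0.
rewrite psumr_eq0 => [/allP H|i _]; last by rewrite -expr2 sqr_ge0.
apply/funext => k; apply/matrixP => i j; apply/eqP; rewrite -subr_eq0.
by have := H (k, i, j) (mem_index_enum _); rewrite /= -expr2 sqrf_eq0.
Qed.

End Rotation_dynamics.

(** * Symmetry, uniqueness and existence for the closed loop on SE(3) *)

Section Closed_loop.
Context {R : realType} {N : nat}.
Implicit Types (g s : config R N) (h : 'M[R]_(3 + 1)).

Definition orientations g : 'I_N -> 'M[R]_3 := fun k => orientation (g k).

Lemma SE3_block h : SE3 h -> h = block_mx (orientation h) (position h) 0 1%:M.
Proof. by move=> [_ h1 h2]; rewrite -h1 -h2 /orientation /position submxK. Qed.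

Lemma block_SE3 (Q : 'M[R]_3) (r : 'cV[R]_3) : SO3 Q -> SE3 (block_mx Q r 0 1%:M).
Proof.
move=> sQ; split; rewrite ?block_mxKdl ?block_mxKdr//.
by rewrite /orientation block_mxKul.
Qed.

Lemma closed_loop_block g k : state g ->
  closed_loop g k = block_mx (spin (orientations g) k) (velocity (g k)) 0 0.
Proof.
move=> sg; rewrite /closed_loop [in LHS](SE3_block (sg k)) mulmx_block.
by rewrite !mul0mx !mulmx0 !addr0.
Qed.

Lemma orientation_mul h h' : SE3 h -> SE3 h' ->
  orientation (h *m h') = orientation h *m orientation h'.
Proof.
move=> /SE3_block-> /SE3_block->; rewrite mulmx_block /orientation !block_mxKul.
by rewrite mulmx0 addr0.
Qed.

Lemma SE3_mul h h' : SE3 h -> SE3 h' -> SE3 (h *m h').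
Proof.
move=> sh sh'; rewrite (SE3_block sh) (SE3_block sh') mulmx_block.
rewrite !mulmx0 !mul0mx !mulmx1 !addr0 add0r.
by apply: block_SE3; apply: SO3_mul; [case: sh|case: sh'].
Qed.

Lemma state_act h g : SE3 h -> state g -> state (act h g).
Proof. by move=> sh sg k; exact: SE3_mul. Qed.

(** The rotation in [h] commutes with the cross product and cancels against its transpose in the
    body frame, so each control is unchanged. *)
Lemma closed_loop_act h g : SE3 h -> state g ->
  closed_loop (act h g) = act h (closed_loop g).
Proof.
move=> sh sg; apply/funext => k; rewrite /closed_loop /act mulmxA.
congr (_ *m twist _); have [sQ _ _] := sh.
have v l : velocity (h *m g l) = orientation h *m velocity (g l).
  by rewrite /velocity orientation_mul// mulmxA.
have va : average_velocity (fun l => h *m g l) = orientation h *m average_velocity g.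
  by rewrite /average_velocity -scalemxAr mulmx_sumr; under eq_bigr do rewrite v.
rewrite /control v va SO3_cross// orientation_mul// trmx_mul -mulmxA.
by rewrite [_ *m (orientation h *m _)]mulmxA SO3_tr_mul// mul1mx.
Qed.

Lemma solution_entry (T : \bar R) (g : R -> config R N) k i j : solution T g ->
  dpath T (fun t => g t k i j) (fun t => closed_loop (g t) k i j).
Proof.
move=> [_ H0 H]; split; first by have /cvg_mxP := H0 k; apply.
by move=> t t0 tT; have /is_derive_mxP := H t k t0 tT; apply.
Qed.

Lemma solution_orientation (T : \bar R) (g : R -> config R N) k i j : solution T g ->
  dpath T (fun t => orientations (g t) k i j) (fun t => spin (orientations (g t)) k i j).
Proof.
move=> Sg; rewrite /orientations /orientation.
under eq_fun do rewrite !mxE.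
have [sg _ _] := Sg.
apply: (dpath_eq (solution_entry k (lshift 1 i) (lshift 1 j) Sg)) => t t0 tT.
by rewrite closed_loop_block ?block_mxEul//; exact/sg/tT/ltW.
Qed.

Lemma solution_position (T : \bar R) (g : R -> config R N) k i : solution T g ->
  dpath T (fun t => position (g t k) i 0) (fun t => velocity (g t k) i 0).
Proof.
move=> Sg; rewrite /position; under eq_fun do rewrite !mxE.
have [sg _ _] := Sg.
apply: (dpath_eq (solution_entry k (lshift 1 i) (rshift 3 0) Sg)) => t t0 tT.
by rewrite closed_loop_block ?block_mxEur//; exact/sg/tT/ltW.
Qed.

Lemma solution_unique (T : \bar R) (g g' : R -> config R N) :
  solution T g -> solution T g' -> g 0 = g' 0 ->
  forall t, 0 <= t -> (t%:E < T)%E -> g t = g' t.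
Proof.
move=> Sg Sg' gg' t t0 tT; have [sg _ _] := Sg; have [sg' _ _] := Sg'.
have O (s : R) : 0 <= s -> (s%:E < T)%E -> orientations (g s) = orientations (g' s).
  apply: (rotations_unique (fun k i j => solution_orientation k i j Sg)
    (fun k i j => solution_orientation k i j Sg')) => [u k u0 uT|].
    by split; [case: (sg u u0 uT k)|case: (sg' u u0 uT k)].
  by rewrite /orientations gg'.
apply/funext => k; rewrite (SE3_block (sg t t0 tT k)) (SE3_block (sg' t t0 tT k)).
congr block_mx; first exact: (congr1 (fun f => f k) (O t t0 tT)).
apply/matrixP => i j; rewrite [j]ord1; apply/eqP; rewrite -subr_eq0; apply/eqP.
have := dpath_const (dpathD (solution_position k i Sg)
  (dpathN (solution_position k i Sg'))) t0 tT.
rewrite gg' subrr; apply => s s0 st.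
have sT : (s%:E < T)%E by apply: lt_trans tT; rewrite lte_fin.
have := congr1 (fun f => f k) (O s (ltW s0) sT); rewrite /orientations /velocity => ->.
exact: subrr.
Qed.

Lemma solution_exists (g0 : config R N) : state g0 ->
  exists2 g : R -> config R N, solution +oo%E g & g 0 = g0.
Proof.
move=> sg0.
have [|Q [B [Q0 sQ DQ QB]]] := @rotations_exist R N (orientations g0).
  by move=> k; case: (sg0 k).
(* The headings are frozen before time 0 in order to be continuous on the whole line. *)
pose x k i (t : R) := Q (Num.max 0 t) k i 0.
have max0 (t : R) : 0 <= Num.max 0 t by rewrite le_max lexx.
have cx k i : continuous (x k i).
  apply: (@lipschitz_continuous R _ `|B|) => s t.
  apply: (le_trans (QB _ _ _ _ _ (max0 s) (max0 t))).
  apply: le_trans (ler_wpM2r (normr_ge0 _) (ler_norm B)) _.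
  by rewrite ler_wpM2l// maxr_lipschitz.
pose r t k : 'cV[R]_3 := \col_i (position (g0 k) i 0 + primitive (x k i) t).
pose g t : config R N := fun k => block_mx (Q t k) (r t k) 0 1%:M.
have oE t : orientations (g t) = Q t.
  by apply/funext => k; rewrite /orientations /orientation block_mxKul.
have sg t : 0 <= t -> state (g t) by move=> t0 k; apply: block_SE3; exact: sQ.
have Dg k i j : dpath +oo (fun t => g t k i j)
    (fun t => block_mx (spin (Q t) k) (Q t k *m e1) 0 0 i j).
  case: (split_ordP i) => i' ->; case: (split_ordP j) => j' ->.
  - by under eq_fun do rewrite block_mxEul; under [X in dpath _ _ X]eq_fun do rewrite block_mxEul.
  - under eq_fun do rewrite block_mxEur mxE.
    apply: (dpath_eq (dpathD (dpath_cst _ _) (dpath_primitive (cx k i')))) => t t0 _.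
    by rewrite add0r block_mxEur [j']ord1 mul_e1 /x max_r// ltW.
  - under eq_fun do rewrite block_mxEdl mxE.
    by apply: (dpath_eq (dpath_cst _ _)) => t _ _; rewrite block_mxEdl mxE.
  - under eq_fun do rewrite block_mxEdr.
    by apply: (dpath_eq (dpath_cst _ _)) => t _ _; rewrite block_mxEdr mxE.
exists g; first split.
- by move=> t t0 _; exact: sg.
- by move=> k; apply/cvg_mxP => i j; case: (Dg k i j).
- move=> t k t0 tT; apply/is_derive_mxP => i j.
  rewrite closed_loop_block; last exact/sg/ltW.
  by rewrite oE /velocity /orientation block_mxKul; case: (Dg k i j) => _; exact.
apply/funext => k; rewrite [RHS](SE3_block (sg0 k)) /g Q0; congr block_mx.
by apply/matrixP => i j; rewrite mxE primitive0 addr0 [j]ord1.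
Qed.

End Closed_loop.

(** * Coherence and equilibria *)

Section Order_parameter.
Context {R : realType} {N : nat}.
Hypothesis N0 : (0 < N)%N.
Implicit Types (s : config R N) (k j : 'I_N).

(** These numbers carry the passage to the shape space: each is the upper left entry of a relative
    orientation, and alignments and coherence are averages of them. *)
Definition gram s k j : R := dot (velocity (s k)) (velocity (s j)).
Definition alignment s k : R := dot (velocity (s k)) (average_velocity s).
Definition coherence s : R := dot (average_velocity s) (average_velocity s).

Definition mean (f : 'I_N -> R) : R := N%:R^-1 * \sum_k f k.

Lemma N_gt0 : 0 < N%:R :> R. Proof. by rewrite ltr0n. Qed.

Lemma mean_cst c : mean (fun=> c) = c.
Proof. by rewrite /mean sumr_const card_ord -[c *+ N]mulr_natl mulKf ?gt_eqF ?N_gt0. Qed.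

Lemma le_mean f f' : (forall k, f k <= f' k) -> mean f <= mean f'.
Proof. by move=> H; rewrite /mean ler_wpM2l ?invr_ge0// ler_sum. Qed.

Lemma norm_mean f c : (forall k, `|f k| <= c) -> `|mean f| <= c.
Proof.
move=> H; rewrite -(mean_cst c) /mean normrM ger0_norm ?invr_ge0//.
by rewrite ler_wpM2l ?invr_ge0// (le_trans (ler_norm_sum _ _ _))// ler_sum.
Qed.

Lemma meanB f f' : mean f - mean f' = mean (fun k => f k - f' k).
Proof. by rewrite /mean -mulrBr -sumrB. Qed.

Lemma le_mean_term f k : (forall j, 0 <= f j) -> f k <= N%:R * mean f.
Proof.
move=> H; rewrite /mean mulrA divff ?mul1r ?gt_eqF ?N_gt0//.
by rewrite (bigD1 k)//= lerDl sumr_ge0.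
Qed.

Lemma dot_mean v s : dot v (average_velocity s) = mean (fun j => dot v (velocity (s j))).
Proof. by rewrite /average_velocity dotZr dot_sumr. Qed.

Lemma alignmentE s k : alignment s k = mean (gram s k).
Proof. exact: dot_mean. Qed.

Lemma coherenceE s : coherence s = mean (alignment s).
Proof.
by rewrite /coherence dot_mean /mean; congr (_ * _); apply: eq_bigr => k _; rewrite dotC.
Qed.

Lemma gram_diag s k : state s -> gram s k k = 1.
Proof. by move=> /(_ k)[sQ _ _]; rewrite /gram /velocity SO3_dot// dot_e1. Qed.

Lemma gram_norm s k j : state s -> `|gram s k j| <= 1.
Proof.
move=> ss; have := cauchy_schwarz (velocity (s k)) (velocity (s j)).
rewrite -/(gram s k k) -/(gram s j j) -/(gram s k j) !gram_diag// mul1r => h.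
by rewrite -(@expr_le1 _ 2)// real_normK// num_real.
Qed.

Lemma alignment_norm s k : state s -> `|alignment s k| <= 1.
Proof. by move=> ss; rewrite alignmentE norm_mean// => j; exact: gram_norm. Qed.

Lemma coherence_norm s : state s -> `|coherence s| <= 1.
Proof. by move=> ss; rewrite coherenceE norm_mean// => j; exact: alignment_norm. Qed.

Lemma coherence_ge0 s : 0 <= coherence s.
Proof. exact: dot_ge0. Qed.

Lemma coherence_le1 s : state s -> coherence s <= 1.
Proof. by move=> ss; apply: le_trans (ler_norm _) (coherence_norm ss). Qed.

Lemma sqr_alignment_le s k : state s -> alignment s k ^+ 2 <= coherence s.
Proof.
move=> ss; have := cauchy_schwarz (velocity (s k)) (average_velocity s).
by rewrite -/(gram s k k) gram_diag// mul1r.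
Qed.

(** The nonnegative numbers [1 - alignment s j] have mean [1 - coherence s], and one of them is at
    most [N] times the mean. *)
Lemma misalignment_le s k c : state s -> 1 - coherence s <= c ->
  1 - alignment s k <= N%:R * c.
Proof.
move=> ss Vc; have := @le_mean_term (fun j => 1 - alignment s j) k.
rewrite -meanB mean_cst -coherenceE => h; apply: le_trans (h _) _.
  by move=> j; rewrite subr_ge0; apply: le_trans (ler_norm _) (alignment_norm _ ss).
by rewrite ler_wpM2l.
Qed.

Lemma velocity_close (h h' : 'M[R]_(3 + 1)) e : frobenius (h - h') < e ->
  dot (velocity h - velocity h') (velocity h - velocity h') <= e ^+ 2.
Proof.
move=> he; apply: (@le_trans _ _ (frobenius (h - h') ^+ 2)); last first.
  by rewrite ler_sqr ?nnegrE ?frobenius_ge0 ?ltW// (le_lt_trans (frobenius_ge0 _) he).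
rewrite sqr_frobenius big_split_ord /=; apply: ler_wpDr.
  by apply: sumr_ge0 => i _; apply: sumr_ge0 => j _; exact: sqr_ge0.
apply: ler_sum => i _; rewrite (bigD1 (lshift 1 0))//=; apply: ler_wpDr.
  by apply: sumr_ge0 => j _; exact: sqr_ge0.
by rewrite -expr2 /velocity add_colE opp_colE !mul_e1 !mxE.
Qed.

Lemma gram_close s s' e k j : state s -> state s' -> state_close e s s' ->
  `|gram s k j - gram s' k j| <= 2 * e.
Proof.
move=> ss ss' cs.
have D (u v w : 'cV[R]_3) l : frobenius (s l - s' l) < e -> dot w w = 1 ->
    u = velocity (s l) -> v = velocity (s' l) -> `|dot (u - v) w| <= e.
  move=> /[dup] fe /velocity_close h w1 -> ->.
  have e0 : 0 <= e := ltW (le_lt_trans (frobenius_ge0 _) fe).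
  rewrite -ler_sqr ?nnegrE// real_normK ?num_real//.
  by apply: (le_trans (cauchy_schwarz _ _)); rewrite w1 mulr1.
have -> : gram s k j - gram s' k j = dot (velocity (s k) - velocity (s' k)) (velocity (s j))
    + dot (velocity (s j) - velocity (s' j)) (velocity (s' k)).
  by rewrite !dotDl !dotNl /gram [dot (velocity (s j)) _]dotC
    [dot (velocity (s' j)) (velocity (s' k))]dotC; ring.
apply: (le_trans (ler_normD _ _)); rewrite mulr_natl mulr2n; apply: lerD.
  by apply: (D _ _ _ k) => //; exact: gram_diag.
by apply: (D _ _ _ j) => //; exact: gram_diag.
Qed.

Lemma alignment_close s s' e k : (forall k j, `|gram s k j - gram s' k j| <= e) ->
  `|alignment s k - alignment s' k| <= e.
Proof. by move=> H; rewrite !alignmentE meanB norm_mean. Qed.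

Lemma coherence_close s s' e : (forall k j, `|gram s k j - gram s' k j| <= e) ->
  `|coherence s - coherence s'| <= e.
Proof.
by move=> H; rewrite !coherenceE meanB norm_mean// => k; exact: alignment_close.
Qed.

Lemma invmx_SE3 (h : 'M[R]_(3 + 1)) : SE3 h ->
  invmx h = block_mx (orientation h)^T (- ((orientation h)^T *m position h)) 0 1%:M.
Proof.
move=> sh; set h' := block_mx _ _ _ _.
have hh' : h *m h' = 1%:M.
  rewrite (SE3_block sh) mulmx_block !mul0mx !mulmx0 !mulmx1 !addr0 add0r.
  have [sQ _ _] := sh; rewrite mulmxN mulmxA SO3_mul_tr// mul1mx addNr.
  by rewrite -scalar_mx_block.
have [uh _] := mulmx1_unit hh'.
by rewrite -[LHS]mulmx1 -hh' mulKmx.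
Qed.

Lemma orientation_shape s k j : state s ->
  orientation (shape_of s k j) = (orientation (s k))^T *m orientation (s j).
Proof.
move=> ss; rewrite /shape_of invmx_SE3// (SE3_block (ss j)) mulmx_block.
by rewrite /orientation !block_mxKul mulmx0 addr0.
Qed.

Lemma gram_shape s k j : state s -> gram s k j = orientation (shape_of s k j) 0 0.
Proof.
by move=> ss; rewrite orientation_shape// mxE; apply: eq_bigr => i _; rewrite !mul_e1 trE.
Qed.

Lemma eq_gram s s' : (forall k j, gram s k j = gram s' k j) ->
  alignment s =1 alignment s' /\ coherence s = coherence s'.
Proof.
move=> H.
have A : alignment s =1 alignment s'.
  by move=> k; rewrite !alignmentE; congr (_ * _); apply: eq_bigr => j _.
by split=> //; rewrite !coherenceE; congr (_ * _); apply: eq_bigr => j _.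
Qed.

Lemma eq_shape_gram s s' k j : state s -> state s' -> shape_of s = shape_of s' ->
  gram s k j = gram s' k j.
Proof. by move=> ss ss' E; rewrite !gram_shape// E. Qed.

Lemma velocity_eq s k j : state s -> gram s k j = 1 -> velocity (s k) = velocity (s j).
Proof.
move=> ss kj; apply/eqP; rewrite -subr_eq0; apply/eqP/dot_eq0.
rewrite dotDl !dotDr !dotNl !dotNr -!/(gram s _ _) !gram_diag//.
by rewrite /gram (dotC (velocity (s j))) -/(gram s k j) kj; ring.
Qed.

Lemma frobenius_block (Q Q' : 'M[R]_3) (r : 'cV[R]_3) :
  frobenius (block_mx Q r 0 1%:M - block_mx Q' r 0 1%:M : 'M[R]_(3 + 1)) = frobenius (Q - Q').
Proof.
rewrite opp_block_mx add_block_mx !subrr; congr Num.sqrt.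
rewrite big_split_ord /= [X in _ + X]big1 ?addr0; last first.
  move=> i _; rewrite big_split_ord /= !big1 ?addr0// => j _;
    by rewrite ?block_mxEdl ?block_mxEdr mxE expr0n.
apply: eq_bigr => i _; rewrite big_split_ord/= [X in _ + X]big1 ?addr0; last first.
  by move=> j _; rewrite block_mxEur mxE expr0n.
by apply: eq_bigr => j _; rewrite block_mxEul.
Qed.

(** Positions are kept, so only the frames contribute to the distance. This produces both the nearby
    equilibria of the convergence and stability proofs and the perturbed state of the instability
    proof. *)
Lemma turn_state s (v : 'I_N -> 'cV[R]_3) : state s ->
  (forall k, dot (v k) (v k) = 1) -> (forall k, -1 < dot (velocity (s k)) (v k)) ->
  exists s', [/\ state s', forall k, velocity (s' k) = v k &
    forall k, frobenius (s k - s' k) ^+ 2 = 4 * (1 - dot (velocity (s k)) (v k))].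
Proof.
move=> ss v1 v0.
have H k : exists Q, [/\ SO3 Q, Q *m e1 = v k &
    frobenius (orientation (s k) - Q) ^+ 2 = 4 * (1 - dot (velocity (s k)) (v k))].
  by have [sQ _ _] := ss k; have [Q [sQ' Qe] Qf] := rotate_to sQ (v1 k) (v0 k); exists Q.
have [Q HQ] := choice H.
exists (fun k => block_mx (Q k) (position (s k)) 0 1%:M); split=> k; have [sQ Qe Qf] := HQ k.
- exact: block_SE3.
- by rewrite /velocity /orientation block_mxKul.
- by rewrite {1}(SE3_block (ss k)) frobenius_block.
Qed.

End Order_parameter.

(** * Equilibria and straight motions *)

Section Straight_motions.
Context {R : realType} {N : nat}.
Hypothesis N0 : (0 < N)%N.
Implicit Types (s : config R N) (k j : 'I_N).

(** The partial sums of the series are constant from index 2 on. *)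
Lemma expm_nilpotent2 (A : 'M[R]_4) : A *m A = 0 -> expm A = 1%:M + A.
Proof.
move=> A2; have H n : (2 <= n)%N ->
    series (fun n => (n`!%:R)^-1 *: A ^+ n) n = 1%:M + A.
  elim: n => // n IH; rewrite leq_eqVlt => /predU1P[[<-]|n2].
    by rewrite /series /= big_nat_recr// big_nat1 /= expr0 expr1 !invr1 !scale1r.
  rewrite -IH// /series /= big_nat_recr//= -[RHS]addr0; congr (_ + _).
  by case: n n2 {IH} => [|[|n]]// _; rewrite !exprS mulrA [A * A]A2 mul0r scaler0.
apply: cvg_lim; first exact: norm_hausdorff.
apply: cvg_near_cst; near=> n; apply: H; near: n; exact: nbhs_infty_ge.
Unshelve. all: by end_near. Qed.

Lemma cross0r (u : 'cV[R]_3) : cross u 0 = 0.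
Proof. by apply: colP3; rewrite crossE !mxE !mulr0 subrr. Qed.

Lemma crossvv (u : 'cV[R]_3) : cross u u = 0.
Proof. by apply: colP3; rewrite crossE mxE; ring. Qed.

Lemma hat0 : hat (0 : 'cV[R]_3) = 0.
Proof.
by apply/matrixP => i j; rewrite mxE [RHS]mxE; elim/ord3_ind: i; rewrite crossE !mxE !mul0r subrr.
Qed.

Definition straight_motion s (t : R) : config R N :=
  fun k => block_mx (orientation (s k)) (position (s k) + t *: velocity (s k)) 0 1%:M.

Lemma straight_motion_Sigma s : state s -> Sigma 0 (straight_motion s).
Proof.
move=> ss.
have s0 : straight_motion s 0 = s.
  by apply/funext => k; rewrite [RHS](SE3_block (ss k)) /straight_motion scale0r addr0.
split=> [|t k t0]; rewrite s0// mulmx0 /twist hat0.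
have E : t *: block_mx 0 e1 0 0 = block_mx 0 (t *: e1) 0 0 :> 'M[R]_(3 + 1).
  by rewrite scale_block_mx !scaler0.
set A : 'M[R]_(3 + 1) := block_mx 0 (t *: e1) 0 0 in E.
have A2 : A *m A = 0.
  by rewrite mulmx_block !mul0mx !mulmx0 !addr0; exact: block_mx_const.
have -> : expm (t *: (block_mx 0 e1 0 0 : 'M[R]_(3 + 1))) = block_mx 1%:M (t *: e1) 0 1%:M :> 'M[R]_(3 + 1).
  rewrite E (expm_nilpotent2 A2).
  transitivity ((block_mx 1%:M 0 0 1%:M : 'M[R]_(3 + 1)) + A).
    by congr (_ + _); exact: scalar_mx_block.
  by rewrite add_block_mx !addr0 add0r.
symmetry; change ((s k : 'M[R]_(3 + 1)) *m (block_mx 1%:M (t *: e1) 0 1%:M : 'M[R]_(3 + 1))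
  = straight_motion s t k).
rewrite {1}(SE3_block (ss k)) mulmx_block.
rewrite !mulmx0 !mul0mx !mulmx1 !addr0 add0r -scalemxAr.
by rewrite /straight_motion [X in _ = block_mx _ X _ _]addrC.
Qed.

(** The controls vanish at [s], and they keep vanishing because the orientations, on which alone
    they depend, are constant along the motion. *)
Lemma straight_motion_solution s : state s ->
  (forall k, cross (velocity (s k)) (average_velocity s) = 0) ->
  solution +oo (straight_motion s).
Proof.
move=> ss eqs.
have oE t k : orientation (straight_motion s t k) = orientation (s k).
  by rewrite /orientation block_mxKul.
have sm t : state (straight_motion s t).
  by move=> k; apply: block_SE3; case: (ss k).
have spin0 t k : closed_loop (straight_motion s t) k = block_mx 0 (velocity (s k)) 0 0.
  rewrite closed_loop_block//.
  have -> : orientations (straight_motion s t) = orientations s by apply/funext => j; exact: oE.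
  rewrite /velocity oE /spin /turn [cross _ _](eqs k).
  by rewrite mulmx0 hat0 mulmx0.
have D k (i j : 'I_(3 + 1)) : dpath +oo (fun t => straight_motion s t k i j)
    (fun t => block_mx 0 (velocity (s k)) 0 0 i j).
  case: (split_ordP i) => i' ->; case: (split_ordP j) => j' ->.
  - under eq_fun do rewrite block_mxEul.
    by apply: (dpath_eq (dpath_cst _ _)) => t _ _; rewrite block_mxEul mxE.
  - under eq_fun do rewrite block_mxEur !mxE.
    apply: (dpath_eq (dpathD (dpath_cst _ _) (dpathM (dpath_id _) (dpath_cst _ _)))) => t _ _.
    by rewrite add0r mul1r mulr0 addr0 block_mxEur !mxE.
  - under eq_fun do rewrite block_mxEdl mxE.
    by apply: (dpath_eq (dpath_cst _ _)) => t _ _; rewrite block_mxEdl mxE.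
  - under eq_fun do rewrite block_mxEdr.
    by apply: (dpath_eq (dpath_cst _ _)) => t _ _; rewrite block_mxEdr mxE.
split=> // [k|t k t0 _].
  by apply/cvg_mxP => i j; case: (D k i j).
by apply/is_derive_mxP => i j; rewrite spin0; case: (D k i j) => _; apply => //; exact: ltry.
Qed.

Lemma states_of_Sigma0 s : state s ->
  (forall k, cross (velocity (s k)) (average_velocity s) = 0) -> states_of (Sigma 0) s.
Proof.
move=> ss eqs; exists (straight_motion s), 0; split=> //.
- exact: straight_motion_solution.
- exact: straight_motion_Sigma.
- by apply/funext => k; rewrite [LHS](SE3_block (ss k)) /straight_motion scale0r addr0.
Qed.

Lemma states_of_Rel_equilibria0 s :
  states_of (Rel_equilibria 0) s <->
  state s /\ forall k j, velocity (s k) = velocity (s j).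
Proof.
split=> [[g [t [[sg _ _] [_ H] t0 ->]]]|[ss eqv]].
  split; first by apply: sg => //; exact: ltry.
  by move=> k j; have := H t k j t0; rewrite !cross0r !addr0.
have eqs k : cross (velocity (s k)) (average_velocity s) = 0.
  rewrite /average_velocity (eq_bigr (fun=> velocity (s k))); last by move=> j _; exact: eqv.
  rewrite sumr_const card_ord -[velocity (s k) *+ N]scaler_nat scalerA mulVf ?scale1r ?crossvv//.
  by rewrite pnatr_eq0 -lt0n.
exists (straight_motion s), 0; split=> //.
- exact: straight_motion_solution.
- split=> [|t k j _]; first exact: straight_motion_Sigma.
  by rewrite !cross0r !addr0 /velocity /orientation !block_mxKul; exact: eqv.
- by apply/funext => k; rewrite [LHS](SE3_block (ss k)) /straight_motion scale0r addr0.
Qed.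

Lemma shape_Rel_equilibria s : state s ->
  (@shape_of R N @` states_of (Rel_equilibria 0)) (shape_of s) ->
  forall k j, gram s k j = 1.
Proof.
move=> ss [s' /states_of_Rel_equilibria0[ss' eqv] E] k j.
by rewrite (eq_shape_gram k j ss ss') // /gram (eqv k j) -/(gram s' j j) gram_diag.
Qed.

End Straight_motions.

(** * Evolution of the coherence and of the alignments *)

Section Coherence_dynamics.
Context {R : realType} {N : nat}.
Hypothesis N0 : (0 < N)%N.
Variables (T : \bar R) (g : R -> config R N).
Hypothesis Sg : solution T g.

Let sg t : 0 <= t -> (t%:E < T)%E -> state (g t).
Proof. by case: Sg => + _ _; exact. Qed.

Let V t := coherence (g t).
Let p k t := alignment (g t) k.

Definition coherence_rate (s : config R N) : R :=
  2 * (coherence s - mean (fun k => alignment s k ^+ 2)).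

Lemma dpath_dot (f df h dh : R -> 'cV[R]_3) :
  (forall i, dpath T (fun t => f t i 0) (fun t => df t i 0)) ->
  (forall i, dpath T (fun t => h t i 0) (fun t => dh t i 0)) ->
  dpath T (fun t => dot (f t) (h t)) (fun t => dot (df t) (h t) + dot (f t) (dh t)).
Proof.
move=> Hf Hh; apply: (dpath_eq (dpath_sum (fun i => dpathM (Hf i) (Hh i)))) => t _ _.
by rewrite big_split.
Qed.

Lemma solution_velocity k i : dpath T (fun t => velocity (g t k) i 0)
  (fun t => (average_velocity (g t) - p k t *: velocity (g t k)) i 0).
Proof.
rewrite /velocity; under eq_fun do rewrite mul_e1.
apply: (dpath_eq (solution_orientation k i 0 Sg)) => t t0 tT.
have [sQ _ _] := sg (ltW t0) tT k.
(* The derivative of the heading is the double cross product of [x_k], [x_av] and [x_k], which the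
   triple product formula expands. *)
rewrite -mul_e1 /spin -mulmxA mul_hat -SO3_cross// /turn mulmxA SO3_mul_tr// mul1mx.
by rewrite cross_cross SO3_dot// dot_e1 scale1r.
Qed.

Lemma solution_average_velocity i : dpath T (fun t => average_velocity (g t) i 0)
  (fun t => (average_velocity (g t) -
    N%:R^-1 *: \sum_k p k t *: velocity (g t k)) i 0).
Proof.
under eq_fun do rewrite /average_velocity scale_colE summxE.
apply: (dpath_eq (dpathM (dpath_cst _ _) (dpath_sum (fun k => solution_velocity k i)))) => t _ _.
rewrite mul0r add0r -summxE -scale_colE sumrB sumr_const card_ord scalerBr.
by rewrite -[average_velocity (g t) *+ N]scaler_nat scalerA mulVf ?scale1r// gt_eqF ?(N_gt0 N0).
Qed.

Lemma dpath_coherence : dpath T V (fun t => coherence_rate (g t)).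
Proof.
apply: (dpath_eq (dpath_dot solution_average_velocity solution_average_velocity)) => t _ _.
have E : dot (N%:R^-1 *: \sum_k p k t *: velocity (g t k)) (average_velocity (g t)) =
    mean (fun k => alignment (g t) k ^+ 2).
  rewrite dotZl dot_suml; congr (_ * _); apply: eq_bigr => k _.
  by rewrite dotZl expr2.
by rewrite [dot (average_velocity _) (_ - _)]dotC dotDl dotNl E /coherence_rate /coherence; ring.
Qed.

(** The derivative of [p_k]; it enters the second derivative of the coherence, whose bound
    Barbalat's lemma calls for. *)
Definition alignment_rate (s : config R N) k : R :=
  coherence s - alignment s k ^+ 2 + alignment s k
  - mean (fun j => alignment s j * gram s k j).

Lemma dpath_alignment k : dpath T (p k) (fun t => alignment_rate (g t) k).
Proof.
apply: (dpath_eq (dpath_dot (solution_velocity k) solution_average_velocity)) => t _ _.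
have E : dot (velocity (g t k)) (N%:R^-1 *: \sum_j p j t *: velocity (g t j)) =
    mean (fun j => alignment (g t) j * gram (g t) k j).
  rewrite dotZr dot_sumr; congr (_ * _); apply: eq_bigr => j _.
  by rewrite dotZr.
rewrite dotDl dotNl dotDr dotNr E dotZl /alignment_rate /coherence -/(alignment _ _) /p.
ring.
Qed.

End Coherence_dynamics.

(** * Asymptotic behaviour *)

Section Asymptotics.
Context {R : realType} {N : nat}.
Hypothesis N0 : (0 < N)%N.
Implicit Types (g : R -> config R N) (s : config R N) (k j : 'I_N).

Definition defect s k : R := coherence s - alignment s k ^+ 2.

Lemma coherence_rateE s : coherence_rate s = 2 * mean (defect s).
Proof. by rewrite -meanB mean_cst. Qed.

Lemma defect_ge0 s k : state s -> 0 <= defect s k.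
Proof. by move=> ss; rewrite subr_ge0 sqr_alignment_le. Qed.

Lemma coherence_rate_ge0 s : state s -> 0 <= coherence_rate s.
Proof.
move=> ss; rewrite coherence_rateE mulr_ge0// -(mean_cst N0 0).
by apply: le_mean => k; exact: defect_ge0.
Qed.

Lemma solution_state g t : solution +oo g -> 0 <= t -> state (g t).
Proof. by case=> + _ _ => H t0; apply: H => //; exact: ltry. Qed.

Lemma coherence_nondecreasing g a b : solution +oo g -> 0 <= a -> a <= b ->
  coherence (g a) <= coherence (g b).
Proof.
move=> Sg a0 ab; apply: (dpath_le (dpath_coherence N0 Sg)) => //; first exact: ltry.
move=> t at_ _; apply/coherence_rate_ge0/(solution_state Sg)/ltW.
exact: le_lt_trans at_.
Qed.

Lemma defect_vanishes g (e : R) : solution +oo g -> 0 < e ->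
  exists2 S, 0 < S & forall t k, S <= t -> defect (g t) k < e.
Proof.
move=> Sg e0; have Np := N_gt0 (R := R) N0.
have DV := dpath_coherence N0 Sg; have Dp := dpath_alignment N0 Sg.
have DW : dpath +oo (fun t => coherence_rate (g t)) (fun t => 2 * (coherence_rate (g t)
    - mean (fun k => 2 * (alignment_rate (g t) k * alignment (g t) k)))).
  have /dpath_eq D := dpathM (dpath_cst _ 2) (dpathD DV (dpathN
    (dpathM (dpath_cst _ N%:R^-1) (dpath_sum (fun k => dpathM (Dp k) (Dp k)))))).
  apply: D => t _ _; rewrite mul0r add0r mul0r add0r.
  congr (_ * (_ - _)); congr (_ * _); apply: eq_bigr => k _; ring.
(* The constant is [2 * (4 + 8)]: 4 bounds the coherence rate, 8 the mean of [2 * p_k' * p_k], and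
   both come from all scalar products being at most 1 in absolute value. *)
have bound t : 0 < t -> `|2 * (coherence_rate (g t)
    - mean (fun k => 2 * (alignment_rate (g t) k * alignment (g t) k)))| <= 24.
  move=> /ltW /(solution_state Sg) st.
  have V1 := coherence_norm N0 st; have p1 k := alignment_norm N0 k st.
  have q1 k : `|alignment (g t) k ^+ 2| <= 1 by rewrite normrX exprn_ile1.
  have m1 k : `|mean (fun j => alignment (g t) j * gram (g t) k j)| <= 1.
    by apply: norm_mean => // j; rewrite normrM mulr_ile1 ?gram_norm.
  have r1 k : `|alignment_rate (g t) k| <= 4.
    rewrite /alignment_rate; move: V1 (p1 k) (q1 k) (m1 k).
    by rewrite !ler_norml => /andP[? ?] /andP[? ?] /andP[? ?] /andP[? ?]; apply/andP; split; lra.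
  have n1 : `|mean (fun k => 2 * (alignment_rate (g t) k * alignment (g t) k))| <= 8.
    apply: norm_mean => // k; rewrite !normrM ger0_norm//.
    have := ler_pM (normr_ge0 _) (normr_ge0 _) (r1 k) (p1 k); lra.
  have n2 : `|coherence_rate (g t)| <= 4.
    rewrite coherence_rateE normrM ger0_norm//.
    suff : `|mean (defect (g t))| <= 2 by lra.
    apply: norm_mean => // k; rewrite /defect; move: V1 (q1 k).
    by rewrite !ler_norml => /andP[? ?] /andP[? ?]; apply/andP; split; lra.
  rewrite [leLHS]normrM (ger0_norm (ler0n _ _)).
  by have := ler_normB (coherence_rate (g t))
    (mean (fun k => 2 * (alignment_rate (g t) k * alignment (g t) k))); lra.
(* One nonnegative defect is at most [N] times their mean, and the coherence rate is twice that
   mean. *)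
have e1 : 0 < e / N%:R by rewrite divr_gt0.
have [|||S S0 HS] := @barbalat R _ _ 1 24 DV _ _ _ (e / N%:R) e1.
- by move=> t t0; apply: coherence_le1 => //; exact: solution_state.
- by move=> t t0; apply: coherence_rate_ge0; apply: solution_state => //; exact: ltW.
- move=> s t s0 st; apply: (dpath_lip DW (ltW s0) st (ltry _)) => u su _.
  by apply: bound; exact: lt_trans su.
exists S => // t k St; have st : state (g t).
  by apply: solution_state => //; apply/ltW/(lt_le_trans S0).
apply: le_lt_trans (le_mean_term N0 k (fun j => defect_ge0 j st)) _.
have := HS t St; rewrite coherence_rateE ltr_pdivlMr// => h.
have m0 : 0 <= mean (defect (g t)).
  by rewrite -(mean_cst N0 0); apply: le_mean => j; exact: defect_ge0.
by have := mulr_ge0 m0 (ltW Np); lra.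
Qed.

(** The cosine [q] of each turning angle lies in [[0, 1]] and satisfies
    [q^2 = 1 - defect s k / coherence s]; then [1 - q <= 1 - q^2] bounds the displacement. The signs
    [c] are left to the caller: those of the alignments for a general equilibrium, all 1 for a
    parallel one. *)
Lemma collinear_state s (c : 'I_N -> R) : state s -> 0 < coherence s ->
  (forall k, c k ^+ 2 = 1) -> (forall k, 0 <= c k * alignment s k) ->
  exists s', [/\ state s',
    forall k, velocity (s' k) = (c k / Num.sqrt (coherence s)) *: average_velocity s &
    forall k, frobenius (s k - s' k) ^+ 2 <= 4 * (defect s k / coherence s)].
Proof.
move=> ss V0 c1 cp; set V := coherence s in V0 *.
have rV0 : 0 < Num.sqrt V by rewrite sqrtr_gt0.
have rV2 : Num.sqrt V ^+ 2 = V by rewrite sqr_sqrtr// ltW.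
pose v k := (c k / Num.sqrt V) *: average_velocity s.
have xv k : dot (velocity (s k)) (v k) = c k * alignment s k / Num.sqrt V.
  by rewrite dotZr mulrAC.
have q0 k : 0 <= c k * alignment s k / Num.sqrt V by rewrite divr_ge0 ?(ltW rV0).
have q2 k : (c k * alignment s k / Num.sqrt V) ^+ 2 = 1 - defect s k / V.
  by rewrite !exprMn c1 mul1r exprVn rV2 /defect -/V; field; rewrite gt_eqF.
have [||s' [ss' vs' fs']] := @turn_state R N s v ss.
- move=> k; rewrite dotZl dotZr -/(coherence s) -/V mulrA -expr2 exprMn c1 mul1r.
  by rewrite exprVn rV2 mulVf// gt_eqF.
- by move=> k; rewrite xv; apply: lt_le_trans (q0 k); rewrite ltrN10.
exists s'; split=> // k; rewrite fs' xv.
have h2 : (c k * alignment s k / Num.sqrt V) ^+ 2 <= 1.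
  by rewrite q2 gerBl divr_ge0 ?(ltW V0)// defect_ge0.
have : c k * alignment s k / Num.sqrt V <= 1 by rewrite -(@expr_le1 _ 2).
move=> h1; have := ler_wpM2l (q0 k) h1; rewrite -expr2 q2; lra.
Qed.

Lemma cross_collinear (a b : R) (u : 'cV[R]_3) : cross (a *: u) (b *: u) = 0.
Proof. by apply: colP3; rewrite crossE !scale_colE mxE; ring. Qed.

Lemma frobenius_lt m n (A : 'M[R]_(m, n)) (e : R) : 0 < e ->
  frobenius A ^+ 2 < e ^+ 2 -> frobenius A < e.
Proof. by move=> e0; rewrite ltr_sqr ?nnegrE ?frobenius_ge0// ltW. Qed.

Lemma converges_to_Sigma0 g : solution +oo g -> converges_to g (states_of (Sigma 0)).
Proof.
move=> Sg e e0.
have [[t0 [t00 V0]]|H] := pselect (exists t0, 0 <= t0 /\ 0 < coherence (g t0)); last first.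
  exists 0 => t t0; have st := solution_state Sg t0; exists (g t).
    apply: states_of_Sigma0 => // k.
    rewrite (_ : average_velocity (g t) = 0) ?cross0r//; apply: dot_eq0.
    apply/eqP; rewrite eq_le [X in _ && X]coherence_ge0 andbT leNgt.
    by apply/negP => V0; apply: H; exists t.
  by move=> k; apply: frobenius_lt => //; rewrite subrr sqr_frobenius big1 ?exprn_gt0// => i _;
    rewrite big1// => j _; rewrite mxE expr0n.
(* Coherence never falls below its value at [t0], so one threshold on the defects serves for all
   later times. *)
have d0 : 0 < e ^+ 2 / 4 * coherence (g t0) by rewrite mulr_gt0// divr_gt0 ?exprn_gt0.
have [S S0 HS] := defect_vanishes Sg d0.
exists (Num.max t0 S) => t; rewrite ge_max => /andP[tt0 tS].
have t_ge0 := le_trans t00 tt0; have st := solution_state Sg t_ge0.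
have VV := coherence_nondecreasing Sg t00 tt0; have Vt := lt_le_trans V0 VV.
pose c k : R := if 0 <= alignment (g t) k then 1 else -1.
have [||s' [ss' vs' fs']] := collinear_state (c := c) st Vt.
- by move=> k; rewrite /c; case: ifP; rewrite ?sqrrN expr1n.
- move=> k; rewrite /c; case: (leP 0 (alignment (g t) k)) => h; first by rewrite mul1r.
  by rewrite mulN1r oppr_ge0 ltW.
exists s'.
  apply: states_of_Sigma0 => // k.
  have -> : average_velocity s' =
      (N%:R^-1 * \sum_j c j / Num.sqrt (coherence (g t))) *: average_velocity (g t).
    by rewrite -scalerA scaler_suml /(average_velocity s'); under eq_bigr do rewrite vs'.
  by rewrite vs' cross_collinear.
move=> k; apply: frobenius_lt => //; apply: le_lt_trans (fs' k) _.
rewrite mulrA ltr_pdivrMr//; have := HS t k tS.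
have : e ^+ 2 * coherence (g t0) <= e ^+ 2 * coherence (g t).
  by rewrite ler_wpM2l// sqr_ge0.
lra.
Qed.

Let E0 : set ('I_N -> config R N) := @shape_of R N @` states_of (Rel_equilibria 0).

(** Two unit vectors [y], [z] within [d] of a common unit vector [x] have scalar product at least
    [1 - 2 * d ^+ 2], because the squared norm of [2 x - y - z] is nonnegative. Averaging over all
    pairs gives the bound. *)
Lemma coherence_near_E0 s (d : R) : state s -> shape_nbhd E0 d (shape_of s) ->
  1 - coherence s <= 2 * d ^+ 2.
Proof.
move=> ss [_ [s0 Es0 <-] [s1 [s2 [ss1 ss2 E1 E2 cl]]]].
have G1 k j : gram s1 k j = 1.
  by apply: (shape_Rel_equilibria N0 ss1); rewrite E1; exists s0.
have G2 k j : 1 - 2 * d ^+ 2 <= gram s k j.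
  rewrite (eq_shape_gram k j ss ss2)//.
  have := velocity_close (cl k); have := velocity_close (cl j).
  rewrite (velocity_eq ss1 (G1 k j)).
  set x := velocity (s1 j); set y := velocity (s2 k); set z := velocity (s2 j).
  move=> hz hy; have := dot_ge0 ((x - y) + (x - z)).
  have : dot x x = 1 := gram_diag j ss1; have : dot y y = 1 := gram_diag k ss2.
  have : dot z z = 1 := gram_diag j ss2; rewrite /gram -/y -/z; move: hy hz.
  rewrite !(dotDl, dotDr, dotNl, dotNr) (dotC y x) (dotC z x) (dotC z y).
  by move=> hy hz yy zz xx; rewrite xx yy zz in hy hz *; lra.
have : 1 - 2 * d ^+ 2 <= coherence s; last by lra.
rewrite coherenceE -(mean_cst N0 (1 - _)); apply: le_mean => k.
by rewrite alignmentE -(mean_cst N0 (1 - _)); apply: le_mean => j; exact: G2.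
Qed.

Lemma near_E0 s (e : R) : state s -> 0 < e -> 0 < coherence s ->
  (forall k, 0 <= alignment s k) ->
  (forall k, 4 * (defect s k / coherence s) < e ^+ 2) -> shape_nbhd E0 e (shape_of s).
Proof.
move=> ss e0 V0 p0 He.
have [||s' [ss' vs' fs']] := collinear_state (c := fun=> 1) ss V0.
- by move=> k; rewrite expr1n.
- by move=> k; rewrite mul1r.
exists (shape_of s').
  exists s' => //; apply/states_of_Rel_equilibria0 => //; split=> // k j.
  by rewrite !vs'.
exists s', s; split=> // k; apply: frobenius_lt => //.
rewrite (_ : frobenius (s' k - s k) = frobenius (s k - s' k)).
  exact: le_lt_trans (fs' k) (He k).
by congr Num.sqrt; apply: eq_bigr => i _; apply: eq_bigr => j _; rewrite -opprB mxE sqrrN.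
Qed.

(** A coherence deficit of at most [1 / (4 N^2)] costs each alignment at most [1 / (4 N)]. Near
    parallel motion no heading can thus be opposed to the average. *)
Lemma alignment_ge_half s (d : R) k : state s -> 1 - coherence s <= 2 * d ^+ 2 ->
  d ^+ 2 <= (8 * N%:R ^+ 2)^-1 -> 1 / 2 <= alignment s k /\ 1 / 2 <= coherence s.
Proof.
move=> ss Vd dN; have Np := N_gt0 (R := R) N0.
have N1 : 1 <= N%:R :> R by rewrite ler1n.
have d2 : 2 * d ^+ 2 <= (4 * N%:R ^+ 2)^-1.
  apply: le_trans (ler_wpM2l _ dN) _ => //; rewrite le_eqVlt; apply/orP; left.
  by apply/eqP; field; rewrite gt_eqF.
have h1 : N%:R * (4 * N%:R ^+ 2)^-1 <= 1 / 4 :> R.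
  rewrite (_ : N%:R * _ = (4 * N%:R)^-1 :> R); last by field; rewrite gt_eqF.
  by rewrite div1r lef_pV2 ?posrE ?mulr_gt0//; lra.
have h2 : (4 * N%:R ^+ 2)^-1 <= 1 / 4 :> R.
  rewrite div1r lef_pV2 ?posrE ?mulr_gt0 ?exprn_gt0//.
  by have := exprn_ege1 2 N1; lra.
have := misalignment_le N0 k ss Vd; have := ler_wpM2l (ltW Np) d2; lra.
Qed.

Lemma stable_E0 : stable E0.
Proof.
move=> e e0; have Np := N_gt0 (R := R) N0.
(* The bound 1 in the minimum keeps alignments and coherence above [1 / 2]. The bound [e] gives
   [N d^2 <= e^2 / 64], hence defects at most [2 (1 - p_k) <= 4 N d^2 <= e^2 / 16], which is small
   enough for [near_E0]. *)
pose d := Num.min 1 e / (8 * N%:R).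
have m0 : 0 < Num.min 1 e by rewrite lt_min ltr01.
have d0 : 0 < d by rewrite divr_gt0 ?mulr_gt0.
have d2E : d ^+ 2 = Num.min 1 e ^+ 2 / (64 * N%:R ^+ 2).
  by rewrite /d; field; rewrite gt_eqF.
have m1 : Num.min 1 e ^+ 2 <= 1 by rewrite expr_le1// ?ge_min ?lexx// ltW.
have me : Num.min 1 e ^+ 2 <= e ^+ 2.
  by rewrite ler_sqr ?nnegrE ?(ltW e0) ?(ltW m0)// ge_min lexx orbT.
have N1 : 1 <= N%:R :> R by rewrite ler1n.
have dN : d ^+ 2 <= (8 * N%:R ^+ 2)^-1.
  rewrite d2E ler_pdivrMr ?mulr_gt0 ?exprn_gt0//.
  rewrite (_ : _^-1 * _ = 8 :> R); first by lra.
  by field; rewrite gt_eqF.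
exists d => // g Sg nb t t0.
have s0 := solution_state Sg (lexx 0); have st := solution_state Sg t0.
have Vd : 1 - coherence (g t) <= 2 * d ^+ 2.
  have := coherence_near_E0 s0 nb; have := coherence_nondecreasing Sg (lexx 0) t0; lra.
have pk k := alignment_ge_half k st Vd dN.
have k0 := Ordinal N0; have [_ Vh] := pk k0.
have V0 : 0 < coherence (g t) by lra.
apply: near_E0 => // k; first by case: (pk k); lra.
have hk := misalignment_le N0 k st Vd.
have pk1 : alignment (g t) k <= 1 by apply: le_trans (ler_norm _) (alignment_norm N0 _ st).
have V1 := coherence_le1 N0 st.
have Dk : defect (g t) k <= 2 * (N%:R * (2 * d ^+ 2)).
  have [ph _] := pk k; have := sqr_ge0 (1 - alignment (g t) k).
  by rewrite /defect sqrrB expr1n mul1r mulr2n; nra.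
have Nd : N%:R * d ^+ 2 <= e ^+ 2 / 64.
  rewrite d2E (_ : _ * _ = Num.min 1 e ^+ 2 / 64 / N%:R); last by field; rewrite gt_eqF.
  rewrite ler_pdivrMr//; apply: (@le_trans _ _ (e ^+ 2 / 64)); first by lra.
  by rewrite ler_peMr// divr_ge0 ?sqr_ge0.
rewrite mulrA ltr_pdivrMr//; have e20 : 0 < e ^+ 2 by rewrite exprn_gt0.
have := ler_wpM2l (ltW e20) Vh; lra.
Qed.

Lemma attractive_E0 : attractive E0.
Proof.
have Np := N_gt0 (R := R) N0.
pose d : R := (8 * N%:R)^-1.
have d0 : 0 < d by rewrite invr_gt0 mulr_gt0.
have dN : d ^+ 2 <= (8 * N%:R ^+ 2)^-1.
  rewrite /d exprVn lef_pV2 ?posrE ?mulr_gt0 ?exprn_gt0 ?mulr_gt0// exprMn.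
  by have := sqr_ge0 (N%:R : R); lra.
exists d => // g Sg nb e e0.
have s0 := solution_state Sg (lexx 0).
(* Since the coherence is at least [1 / 2], defects below [e ^+ 2 / 8] meet the requirement of
   [near_E0]. *)
have e4 : 0 < e ^+ 2 / 8 by rewrite divr_gt0 ?exprn_gt0.
have [S S0 HS] := defect_vanishes Sg e4; exists S => t St.
have t0 : 0 <= t by apply: le_trans St; exact: ltW.
have st := solution_state Sg t0.
have Vd : 1 - coherence (g t) <= 2 * d ^+ 2.
  have := coherence_near_E0 s0 nb; have := coherence_nondecreasing Sg (lexx 0) t0; lra.
have pk k := alignment_ge_half k st Vd dN.
have k0 := Ordinal N0; have [_ Vh] := pk k0.
have V0 : 0 < coherence (g t) by lra.
apply: near_E0 => // k; first by case: (pk k); lra.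
rewrite mulrA ltr_pdivrMr//; have := HS t k St.
have := ler_wpM2l (ltW e4) Vh; lra.
Qed.

End Asymptotics.

(** * Instability of the other limit sets *)

Section Instability.
Context {R : realType} {N : nat}.
Hypothesis N0 : (0 < N)%N.
Implicit Types (g : R -> config R N) (s : config R N) (k j : 'I_N).

Definition gram_limit g s : Prop := forall e T : R, 0 < e ->
  exists2 t, T <= t /\ 0 <= t & forall k j, `|gram s k j - gram (g t) k j| <= e.

(* Only relative orientations matter, so both kinds of limit sets are covered. *)
Lemma positive_limit_gram g L sigma : solution +oo g ->
  L = shape_limit_set g \/ L = orientation_limit_set g -> L sigma ->
  exists s, [/\ state s, shape_of s = sigma & gram_limit g s].
Proof.
move=> Sg [->|->] [[s ss sE] H]; exists s; split=> // e T e0.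
- have e2 : 0 < e / 2 by rewrite divr_gt0.
  have [t Tt [s1 [s2 [ss1 ss2 E1 E2 cl]]]] := H (e / 2) (Num.max T 0) e2.
  move: Tt; rewrite ge_max => /andP[Tt t0]; exists t => // k j.
  have st := solution_state Sg t0.
  rewrite (eq_shape_gram k j ss ss1) ?sE ?E1// (eq_shape_gram k j st ss2) ?E2//.
  by apply: le_trans (gram_close k j ss1 ss2 cl) _; lra.
- have [t Tt cl] := H e (Num.max T 0) e0.
  move: Tt; rewrite ge_max => /andP[Tt t0]; exists t => // k j.
  have st := solution_state Sg t0; apply/ltW; apply: le_lt_trans (cl k j).
  rewrite (gram_shape k j ss) (gram_shape k j st) -sE distrC.
  rewrite -ler_sqr ?nnegrE ?frobenius_ge0// sqr_frobenius real_normK ?num_real//.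
  rewrite (bigD1 0)//= (bigD1 0)//= -addrA !mxE lerDl addr_ge0 ?sumr_ge0// => i _.
    exact: sqr_ge0.
  by apply: sumr_ge0 => l _; exact: sqr_ge0.
Qed.

(** A time at which the motion is close to [s] is followed by one at which it is close to [s'], and
    coherence has not decreased in between. By symmetry coherence is constant on a limit set. *)
Lemma limit_coherence_le g s s' : solution +oo g -> gram_limit g s -> gram_limit g s' ->
  coherence s <= coherence s'.
Proof.
move=> Sg Ls Ls'; apply/ler_addgt0Pr => e e0.
have e2 : 0 < e / 2 by rewrite divr_gt0.
have [t [_ t0] Ht] := Ls _ 0 e2; have [t' [tt' _] Ht'] := Ls' _ t e2.
have := coherence_close N0 Ht; have := coherence_close N0 Ht'.
have := coherence_nondecreasing N0 Sg t0 tt'.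
by rewrite !ler_norml => ? /andP[? ?] /andP[? ?]; lra.
Qed.

Lemma limit_defect g s k : solution +oo g -> state s -> gram_limit g s ->
  defect s k = 0.
Proof.
move=> Sg ss Ls; apply/eqP; rewrite eq_le defect_ge0// andbT.
apply/ler_addgt0Pr => e e0; rewrite add0r.
have e4 : 0 < e / 4 by rewrite divr_gt0.
have [S S0 HS] := defect_vanishes N0 Sg e4.
have [t [St t0] Ht] := Ls _ S e4.
have := HS t k St; have := coherence_close N0 Ht; have := alignment_close N0 k Ht.
have := alignment_norm N0 k ss; have := alignment_norm N0 k (solution_state Sg t0).
rewrite /defect !ler_norml.
set a := alignment s k; set b := alignment (g t) k; set u := coherence s.
set v := coherence (g t).
move=> /andP[b1 b2] /andP[a1 a2] /andP[h1 h2] /andP[h3 h4] h5.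
have : b ^+ 2 - a ^+ 2 <= e / 2.
  have -> : b ^+ 2 - a ^+ 2 = (b - a) * (b + a) by ring.
  apply: (le_trans (ler_norm _)); rewrite normrM (_ : e / 2 = e / 4 * 2); last by field.
  by apply: ler_pM => //; rewrite ler_norml; apply/andP; split; lra.
lra.
Qed.

(* Each normalized alignment is within [d] of a sign. *)
Lemma near_integer_coherence s (d : R) : state s -> 0 < coherence s ->
  (forall k, defect s k <= d * coherence s) ->
  exists m : int, `|N%:R * Num.sqrt (coherence s) - m%:~R| <= N%:R * d.
Proof.
move=> ss V0 Hd; have Np := N_gt0 (R := R) N0; set V := coherence s in V0 Hd *.
have rV0 : 0 < Num.sqrt V by rewrite sqrtr_gt0.
have rV2 : Num.sqrt V ^+ 2 = V by rewrite sqr_sqrtr// ltW.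
pose q k := alignment s k / Num.sqrt V.
pose c k : int := if 0 <= alignment s k then 1 else -1.
exists (\sum_k c k).
have -> : N%:R * Num.sqrt V = \sum_k q k.
  rewrite -mulr_suml; apply: (mulIf (lt0r_neq0 rV0)).
  rewrite divfK ?gt_eqF// -mulrA -expr2 rV2 /V coherenceE /mean mulrA divff ?mul1r//.
  by rewrite gt_eqF.
rewrite rmorph_sum/= -sumrB; apply: le_trans (ler_norm_sum _ _ _) _.
rewrite mulr_natl -[N in d *+ N]card_ord -sumr_const; apply: ler_sum => k _.
have q2 : q k ^+ 2 = 1 - defect s k / V.
  by rewrite exprMn exprVn rV2 /defect -/V; field; rewrite gt_eqF.
have dk : defect s k / V <= d by rewrite ler_pdivrMr.
have d0 : 0 <= defect s k / V by rewrite divr_ge0 ?(ltW V0)// defect_ge0.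
rewrite /c; case: (leP 0 (alignment s k)) => h.
  have q0 : 0 <= q k by rewrite divr_ge0// ltW.
  have q1 : q k <= 1 by rewrite -(@expr_le1 _ 2)// q2; lra.
  have := ler_wpM2l q0 q1; rewrite -expr2 q2 ler_norml => ?; apply/andP; split; lra.
have q0 : 0 <= - q k by rewrite /q -mulNr divr_ge0 ?oppr_ge0 ?(ltW h) ?(ltW rV0).
have q1 : - q k <= 1 by rewrite -(@expr_le1 _ 2)// sqrrN q2; lra.
have := ler_wpM2l q0 q1; rewrite -expr2 sqrrN q2 ler_norml rmorphN rmorph1 => ?.
by apply/andP; split; lra.
Qed.

Lemma integer_coherence s : state s -> (forall k, defect s k = 0) ->
  exists m : int, N%:R * Num.sqrt (coherence s) = m%:~R.
Proof.
move=> ss Hd; have := coherence_ge0 s; rewrite le_eqVlt => /predU1P[<-|V0].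
  by exists 0; rewrite sqrtr0 mulr0.
have [|m] := @near_integer_coherence s 0 ss V0.
  by move=> k; rewrite Hd mul0r.
by rewrite mulr0 normr_le0 subr_eq0 => /eqP; exists m.
Qed.

(** Zero defect is the equality case of Cauchy-Schwarz, so [x_av = p_k x_k] with [p_k^2 = V]. If all
    [p_k] were positive, all would equal the square root of [V] and the headings would coincide. *)
Lemma exists_misaligned s : state s -> (forall k, defect s k = 0) ->
  ~ (forall k j, velocity (s k) = velocity (s j)) ->
  exists k (a : R), 0 <= a /\ average_velocity s = - a *: velocity (s k).
Proof.
move=> ss Hd Hv.
have para k : average_velocity s = alignment s k *: velocity (s k).
  have := Hd k; rewrite /defect /coherence /alignment; have := gram_diag k ss.
  rewrite /gram; move: (velocity (s k)) (average_velocity s) => x u x1 h.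
  apply/eqP; rewrite -subr_eq0; apply/eqP/dot_eq0; rewrite -h.
  by rewrite !(dotDl, dotDr, dotNl, dotNr, dotZl, dotZr) x1 (dotC u x); ring.
have [[k ak]|H] := pselect (exists k, alignment s k <= 0).
  by exists k, (- alignment s k); rewrite oppr_ge0 opprK.
exfalso; apply: Hv => k j.
have p0 l : 0 < alignment s l by rewrite ltNge; apply/negP => h; apply: H; exists l.
have pE l : alignment s l = Num.sqrt (coherence s).
  have := Hd l => /eqP; rewrite subr_eq0 => /eqP->.
  by rewrite sqrtr_sqr gtr0_norm.
have := para k; rewrite {1}(para j) !pE => /scalerI-> //.
by rewrite -(pE k) gt_eqF.
Qed.

(* The rotated velocity is [c x_k + w y_k] with [(c, w)] on the unit circle, given by
   the rational parametrization with parameter [tau]. *)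
Lemma perturb s k (a d : R) : state s -> 0 <= a ->
  average_velocity s = - a *: velocity (s k) -> 0 < d ->
  exists s', [/\ state s', state_close d s s' & coherence s < coherence s'].
Proof.
move=> ss a0 aE d0; have [sQ _ _] := ss k.
(* The squared displacement is [4 (1 - c) <= 8 tau^2], at most [d^2 / 2] when [tau <= d / 4]. *)
pose tau := Num.min 1 (d / 4); have t0 : 0 < tau by rewrite lt_min ltr01 divr_gt0.
have t1 : 1 + tau ^+ 2 != 0 by rewrite gt_eqF// ltr_wpDr ?sqr_ge0.
have t1' : 0 < 1 + tau ^+ 2 by rewrite ltr_wpDr ?sqr_ge0.
pose c := (1 - tau ^+ 2) / (1 + tau ^+ 2); pose w := 2 * tau / (1 + tau ^+ 2).
pose u : 'cV[R]_3 := \col_i nth 0 [:: c; w; 0] i.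
have uE : u 0 0 = c /\ u 1 0 = w /\ u 2 0 = 0 by rewrite !mxE.
case: uE => u0 [u1 u2].
have uu : dot u u = 1 by rewrite dotE u0 u1 u2 /c /w; field.
pose v j := if j == k then orientation (s k) *m u else velocity (s j).
have xk : dot (velocity (s k)) (orientation (s k) *m u) = c.
  by rewrite SO3_dot// dotE u0 u1 u2 !mxE /= mul1r !mul0r !addr0.
have c1 : 1 - c = 2 * tau ^+ 2 / (1 + tau ^+ 2) by rewrite /c; field.
have c2 : 1 - c <= 2 * tau ^+ 2.
  by have := sqr_ge0 tau; rewrite c1 ler_pdivrMr//; nra.
have c3 : -1 < c.
  have -> : c = 2 / (1 + tau ^+ 2) - 1 by rewrite /c; field.
  by rewrite ltrBrDr addNr divr_gt0.
have [||s' [ss' vs' fs']] := @turn_state R N s v ss.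
- by move=> j; rewrite /v; case: eqP => _; [rewrite SO3_dot|exact: gram_diag].
- by move=> j; rewrite /v; case: eqP => [->|_]; rewrite ?xk// -/(gram s j j) gram_diag//; lra.
have fk j : frobenius (s j - s' j) ^+ 2 < d ^+ 2.
  rewrite fs' /v; case: eqP => [->|_]; last first.
    by rewrite -/(gram s j j) gram_diag// subrr mulr0 exprn_gt0.
  rewrite xk; apply: (@le_lt_trans _ _ (4 * (2 * tau ^+ 2))); first by rewrite ler_wpM2l.
  have : tau ^+ 2 <= (d / 4) ^+ 2.
    by rewrite ler_sqr ?nnegrE ?divr_ge0 ?(ltW t0) ?(ltW d0)// ge_min lexx orbT.
  by rewrite exprMn exprVn; have := exprn_gt0 2 d0; lra.
exists s'; split=> // [j|]; first exact: frobenius_lt.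
have c0 : 0 < 1 - c by rewrite c1 divr_gt0 ?mulr_gt0 ?exprn_gt0.
set x := velocity (s k) in xk aE; set y := orientation (s k) *m u in xk v vs' fs'.
have x1 : dot x x = 1 := gram_diag k ss.
have y1 : dot y y = 1 by rewrite SO3_dot.
have Np := N_gt0 (R := R) N0; have nN : N%:R != 0 :> R by rewrite gt_eqF.
(* The average moves by [(y - x) / N]. The cross term with [- a *: x] is nonnegative, and the square
   of the displacement makes the increase strict even when [a = 0]. *)
have -> : coherence s' = coherence s + 2 * N%:R^-1 * a * (1 - c) + 2 * N%:R^-1 ^+ 2 * (1 - c).
  have -> : coherence s' = dot (average_velocity s + N%:R^-1 *: (y - x))
      (average_velocity s + N%:R^-1 *: (y - x)).
    have -> : average_velocity s + N%:R^-1 *: (y - x) = average_velocity s'; last by [].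
    rewrite /average_velocity -scalerDr (bigD1 k)//= [in RHS](bigD1 k)//= vs' /v eqxx.
    rewrite (eq_bigr (fun j => velocity (s' j))).
      by congr (_ *: _); rewrite -/x [LHS]addrC addrA subrK.
    by move=> j jk; rewrite vs' /v (negbTE jk).
  rewrite /coherence aE !(dotDl, dotDr, dotNl, dotNr, dotZl, dotZr) x1 y1 (dotC y x) xk.
  ring.
rewrite -addrA ltrDl ltr_wpDl//.
  by rewrite !mulr_ge0 ?invr_ge0 ?(ltW c0).
by rewrite !mulr_gt0 ?exprn_gt0 ?invr_gt0.
Qed.

(** At one late time [N |x_av|] is within [eta] of an integer [m]. It is still at least its initial
    value, which exceeds [M + eta], so [m >= M + 1]; and [eta <= 1 / 2] leaves at least
    [M + 1 / 2]. *)
Lemma coherence_escapes g (M : int) : solution +oo g ->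
  M%:~R < N%:R * Num.sqrt (coherence (g 0)) -> 0 <= M ->
  exists2 t, 0 <= t & M%:~R + 1 / 2 <= N%:R * Num.sqrt (coherence (g t)).
Proof.
move=> Sg M0 M_ge0; have Np := N_gt0 (R := R) N0.
set r0 := N%:R * _ in M0.
pose eta := Num.min (r0 - M%:~R) (1 / 2) / 2.
have eta0 : 0 < eta by rewrite divr_gt0// lt_min subr_gt0 M0 divr_gt0.
have eta1 : eta < r0 - M%:~R.
  have : Num.min (r0 - M%:~R) (1 / 2) <= r0 - M%:~R by rewrite ge_min lexx.
  by rewrite /eta; move: M0 eta0; rewrite /eta; lra.
have eta2 : eta <= 1 / 2.
  have : Num.min (r0 - M%:~R) (1 / 2) <= 1 / 2 by rewrite ge_min lexx orbT.
  by rewrite /eta; move: M0 eta0; rewrite /eta; lra.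
have V0 : 0 < coherence (g 0).
  rewrite lt_neqAle coherence_ge0 andbT eq_sym; apply/eqP => V0.
  by move: M0; rewrite /r0 V0 sqrtr0 mulr0 ltNge ler0z M_ge0.
have e0 : 0 < eta / N%:R * coherence (g 0) by rewrite mulr_gt0// divr_gt0.
have [S S0 HS] := defect_vanishes N0 Sg e0.
have S_ge0 := ltW S0; have st := solution_state Sg S_ge0.
have VV := coherence_nondecreasing N0 Sg (lexx 0) S_ge0.
have VS : 0 < coherence (g S) by exact: lt_le_trans VV.
have [k|m] := @near_integer_coherence (g S) (eta / N%:R) st VS.
  apply: le_trans (ltW (HS S k (lexx S))) _.
  by rewrite ler_wpM2l// divr_ge0// ltW.
rewrite [N%:R * (eta / _)]mulrC divfK ?gt_eqF// ler_norml => /andP[h1 h2].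
have rS : r0 <= N%:R * Num.sqrt (coherence (g S)).
  by rewrite /r0 ler_wpM2l ?(ltW Np)// ler_wsqrtr.
have : (M + 1)%:~R <= m%:~R :> R.
  by rewrite ler_int lezD1 -(ltr_int R); lra.
rewrite rmorphD /= => h3; exists S => //; lra.
Qed.

Lemma unstable_limit_set (L : set ('I_N -> config R N)) : positive_limit_set L ->
  ~ (L `<=` @shape_of R N @` states_of (Rel_equilibria 0)) -> unstable L.
Proof.
move=> [g Sg LE] nL stL; have Np := N_gt0 (R := R) N0.
have [sigma Ls nE] : exists2 sigma, L sigma &
    ~ (@shape_of R N @` states_of (Rel_equilibria 0)) sigma.
  by apply: contrapT => H; apply: nL => sigma Ls; apply: contrapT => nE; apply: H; exists sigma.
have [s [ss sE lims]] := positive_limit_gram Sg LE Ls.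
have Hd k := limit_defect k Sg ss lims.
have [|k [a [a0 aE]]] := exists_misaligned ss Hd.
  move=> Hv; apply: nE; exists s => //.
  exact/states_of_Rel_equilibria0.
have [M ME] := integer_coherence ss Hd.
have M0 : 0 <= M by rewrite -(ler0z R) -ME mulr_ge0 ?sqrtr_ge0 ?(ltW Np).
(* Within distance [e] of [L], Gram entries and coherence vary by at most [2 * e], so [N^2 V] by at
   most [1 / 8]; the escape raises [N^2 V] from [M^2] to at least [(M + 1/2)^2 >= M^2 + 1/4]. *)
pose e : R := (16 * N%:R ^+ 2)^-1.
have e0 : 0 < e by rewrite invr_gt0 mulr_gt0 ?exprn_gt0.
have [d d0 Hstab] := stL e e0.
have [s' [ss' cs' Vs']] := perturb ss a0 aE d0.
have [g' Sg' g'0] := solution_exists ss'.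
have [||t t0 Ht] := coherence_escapes (M := M) Sg'.
- by rewrite -ME g'0 ltr_pM2l// ltr_sqrt// (le_lt_trans _ Vs')// coherence_ge0.
- by [].
have st := solution_state Sg' t0.
have [|tau Ltau [s1 [s2 [ss1 ss2 E1 E2 cl]]]] := Hstab g' Sg' _ t t0.
  by rewrite g'0; exists sigma => //; exists s, s'.
have [s3 [ss3 s3E lim3]] := positive_limit_gram Sg LE Ltau.
have G13 : coherence s1 = coherence s.
  have [_ ->] := eq_gram (fun k j => eq_shape_gram k j ss1 ss3 (etrans E1 (esym s3E))).
  by apply/eqP; rewrite eq_le !(limit_coherence_le Sg).
have G2t : coherence s2 = coherence (g' t).
  by have [_ ->] := eq_gram (fun k j => eq_shape_gram k j ss2 st E2).
have := coherence_close N0 (fun k j => gram_close k j ss1 ss2 cl).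
rewrite G13 G2t ler_norml => /andP[h _].
have sq s0 : (N%:R * Num.sqrt (coherence s0)) ^+ 2 = N%:R ^+ 2 * coherence s0.
  by rewrite exprMn sqr_sqrtr// coherence_ge0.
have Mr : 0 <= M%:~R :> R by rewrite ler0z.
have h1 : (M%:~R + 1 / 2) ^+ 2 <= N%:R ^+ 2 * coherence (g' t).
  by rewrite -sq ler_sqr ?nnegrE ?addr_ge0 ?divr_ge0 ?mulr_ge0 ?sqrtr_ge0 ?(ltW Np).
have h2 : N%:R ^+ 2 * coherence s = M%:~R ^+ 2 by rewrite -sq ME.
have h3 : N%:R ^+ 2 * (2 * e) = 1 / 8 by rewrite /e; field; rewrite gt_eqF.
have N2 : 0 <= N%:R ^+ 2 :> R by rewrite sqr_ge0.
have := ler_wpM2l N2 h; move: h1; rewrite sqrrD; lra.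
Qed.

End Instability.

Theorem theorem1 (R : realType) (N : nat) (hN : (0 < N)%N) :
  [/\ (* invariance of the closed-loop vector field under SE(3) *)
      forall (h : 'M[R]_(3 + 1)) (g : config R N), SE3 h -> state g ->
        state (act h g) /\ closed_loop (act h g) = act h (closed_loop g),
      (* every solution exists for all t >= 0 *)
      (forall g0 : config R N, state g0 ->
         exists2 g : R -> config R N, solution +oo%E g & g 0 = g0) /\
      (forall (T : R) (g : R -> config R N), 0 < T -> solution T%:E g ->
         exists2 g' : R -> config R N, solution +oo%E g' &
           forall t : R, 0 <= t -> t < T -> g' t = g t),
      (* convergence to Sigma(0) *)
      forall g : R -> config R N, solution +oo%E g ->
        converges_to g (states_of (Sigma 0)),
      (* asymptotic stability of E(0) in the shape space *)
      asymptotically_stable (@shape_of R N @` states_of (Rel_equilibria 0)) &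
      (* instability of the other positive limit sets *)
      forall L : set ('I_N -> config R N), positive_limit_set L ->
        ~ (L `<=` @shape_of R N @` states_of (Rel_equilibria 0)) ->
        unstable L].
Proof.
split.
- by move=> h g sh sg; split; [exact: state_act|exact: closed_loop_act].
- split=> [g0|T g T0 Sg]; first exact: solution_exists.
  have [sg cg Dg] := Sg.
  have sg0 : state (g 0) by apply: sg => //; rewrite lte_fin.
  have [g' Sg' g'0] := solution_exists sg0; exists g' => // t t0 tT.
  have Sg'T : solution T%:E g'.
    have [sg' cg' Dg'] := Sg'; split=> // [u u0 _|u k u0 _].
      by apply: sg' => //; exact: ltry.
    by apply: Dg' => //; exact: ltry.
  exact: (solution_unique Sg'T Sg g'0 t0).
- exact: converges_to_Sigma0.
- by split; [exact: stable_E0|exact: attractive_E0].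
- exact: unstable_limit_set.
Qed.
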